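(* Let $T>0$ and $\mathcal O=(0,\pi)$. Let $G$, $\Delta G$ be the Green function kernels and, for $n\ge2$, let $G^n$, $\Delta_nG^n$ be the discrete kernels defined in the context. There exists a constant $C=C(T)$ (independent of $n$) such that for all $n\ge2$, $x\in\mathcal O$ and $t\in(0,T]$, $$\int_0^t\int_{\mathcal O}|\Delta_nG^n_s(x,y)-\Delta G_s(x,y)|\,dy\,ds\le Cn^{-1},$$ $$\int_0^t\int_{\mathcal O}|G^n_s(x,y)-G_s(x,y)|^2\,dy\,ds\le Cn^{-2}.$$
   Context: Let $\lambda_j=-j^2$ and $\phi_j(x)=\sqrt{2/\pi}\sin(jx)$ for $j\ge1$, and $$G_t(x,y)=\sum_{j\ge1}e^{-\lambda_j^2t}\phi_j(x)\phi_j(y),\qquad \Delta G_t(x,y)=\sum_{j\ge1}\lambda_je^{-\lambda_j^2t}\phi_j(x)\phi_j(y)$$ (the Green function of $\partial_t+\Delta^2$ on $\mathcal O=(0,\pi)$ with boundary conditions $u=\Delta u=0$, and its Laplacian). For $n\ge2$ let $h=\pi/n$, $\kappa_n(y)=h\lfloor y/h\rfloor$, $\lambda_{j,n}=-j^2c_{j,n}$ with $c_{j,n}=\sin^2(\frac{j\pi}{2n})/(\frac{j\pi}{2n})^2$, and let $\phi_{j,n}$ be the piecewise linear interpolant of $\phi_j$ on the grid $\{0,h,\dots,nh=\pi\}$: $\phi_{j,n}(x)=\phi_j(kh)+(\frac{n}{\pi}x-k)(\phi_j((k+1)h)-\phi_j(kh))$ for $x\in[kh,(k+1)h]$, $0\le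 k\le n-1$. The discrete kernels are $$G^n_t(x,y)=\sum_{j=1}^{n-1}e^{-\lambda_{j,n}^2t}\phi_{j,n}(x)\phi_j(\kappa_n(y)),\qquad \Delta_nG^n_t(x,y)=\sum_{j=1}^{n-1}\lambda_{j,n}e^{-\lambda_{j,n}^2t}\phi_{j,n}(x)\phi_j(\kappa_n(y)).$$ *)

(* Defs.v *)
From HB Require Import structures.
From mathcomp Require Import all_boot all_order all_algebra.
From mathcomp Require Import all_classical all_reals all_analysis.

Set Implicit Arguments.
Unset Strict Implicit.
Unset Printing Implicit Defensive.

Import Order.TTheory GRing.Theory Num.Theory.
Import numFieldNormedType.Exports.

Local Open Scope classical_set_scope.
Local Open Scope ring_scope.

Section GreenKernels.
Variable R : realType.
Implicit Types (j n : nat) (t x y : R).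

Definition lam j : R := - j%:R ^+ 2.

Definition phi j x : R := Num.sqrt (2 / pi) * sin (j%:R * x).

(* Both series converge absolutely when t > 0; for t <= 0, limn of a
   non-convergent sequence of partial sums is a junk value. *)
Definition green t x y : R :=
  limn (fun N : nat =>
    \sum_(1 <= j < N) expR (- (lam j ^+ 2 * t)) * phi j x * phi j y).

Definition lap_green t x y : R :=
  limn (fun N : nat =>
    \sum_(1 <= j < N) lam j * expR (- (lam j ^+ 2 * t)) * phi j x * phi j y).

Definition mesh n : R := pi / n%:R.

Definition kappa n y : R := mesh n * (Num.floor (y / mesh n))%:~R.

Definition cfactor j n : R :=
  sin (j%:R * pi / (2 * n%:R)) ^+ 2 / (j%:R * pi / (2 * n%:R)) ^+ 2.

Definition lamn j n : R := - j%:R ^+ 2 * cfactor j n.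

Definition phin j n x : R :=
  let k : R := (Num.floor (x / mesh n))%:~R in
  phi j (k * mesh n) +
  (n%:R / pi * x - k) * (phi j ((k + 1) * mesh n) - phi j (k * mesh n)).

(* phin agrees with the affine formula on every closed cell, right end
   included. *)
Lemma phinE j n k x : (0 < n)%N -> k%:R * mesh n <= x <= k.+1%:R * mesh n ->
  phin j n x = phi j (k%:R * mesh n) +
    (n%:R / pi * x - k%:R) * (phi j (k.+1%:R * mesh n) - phi j (k%:R * mesh n)).
Proof.
move=> n0 /andP[kx xk].
have h0 : 0 < mesh n by rewrite divr_gt0 ?pi_gt0 ?ltr0n.
have xE : n%:R / pi * x = x / mesh n by rewrite /mesh invf_div mulrC.
have [xk1|xk1] := eqVneq x (k.+1%:R * mesh n); last first.
  have fl : Num.floor (x / mesh n) = k%:Z.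
    apply: floor_def; rewrite ler_pdivlMr// ltr_pdivrMr// intrD -!pmulrn kx.
    by rewrite natr1 lt_neqAle xk1.
  by rewrite /phin fl -pmulrn natr1.
have fl : Num.floor (x / mesh n) = k.+1%:Z.
  by rewrite xk1 mulfK ?gt_eqF// -[k.+1%:R]/(k.+1%:~R) intrKfloor.
rewrite /phin fl -pmulrn xE xk1 mulfK ?gt_eqF// subrr mul0r addr0.
have -> : k.+1%:R - k%:R = 1 :> R by rewrite -natr1 addrAC subrr add0r.
by rewrite mul1r addrC subrK.
Qed.

Definition greenn n t x y : R :=
  \sum_(1 <= j < n)
    expR (- (lamn j n ^+ 2 * t)) * phin j n x * phi j (kappa n y).

Definition lap_greenn n t x y : R :=
  \sum_(1 <= j < n)
    lamn j n * expR (- (lamn j n ^+ 2 * t)) * phin j n x * phi j (kappa n y).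

End GreenKernels.

(* Main.v *)
Require Import Defs.
From HB Require Import structures.
From mathcomp Require Import all_boot all_order all_algebra.
From mathcomp Require Import all_classical all_reals all_analysis.
From mathcomp Require Import measurable_realfun.
From mathcomp Require Import ring lra.

Import Order.TTheory GRing.Theory Num.Theory.
Import numFieldNormedType.Exports.

Local Open Scope classical_set_scope.
Local Open Scope ring_scope.

(** Write h = pi / n and let g be the exact kernel truncated to the modes j < n.
    The difference of the discrete and the exact kernel, as a function of y, is
    the sum of three errors:
    - the coefficient error: for j < n, the factor in (s, x) of the discrete
      kernel is replaced by the exact one.  Interpolation costs (j h)^2, and so
      does the change of eigenvalue, because 1 - c_{j,n} <= (j h)^2 and the
      factor s j^4 that comes down from the exponent is absorbed by the
      exponential ([green_coef_le], [lap_coef_le]);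
    - the shift error g o kappa_n - g;
    - the tail of the exact series over j >= n.

    Every bound is put in the form of a series of exponentials exp (- j^4 s / 512)
    with nonnegative weights, which is integrated over time term by term, each
    exponential giving at most 512 / j^4 ([time_integral_le]).  The rate 1/512 is
    half of the square of 1/16, a lower bound for c_{j,n}.

    The triangle inequality is enough for the first and third errors: after the
    time integration each of the n modes contributes O(h^2) to the first, and the
    third is a sum of 1/j^2 over j >= n.

    For the shift error the triangle inequality would give h * sum_{j<n} 1/j, a
    logarithm too much, and orthogonality is needed.  For a fixed offset r < h
    the numbers g (k h) - g (k h + r) are the values at k h of a cosine polynomial
    of degree < n, so the sum of their squares over a whole period 0 <= k < 2 n
    is given by a discrete Parseval identity ([grid_parseval]).  Integration over
    r bounds the squared L^2 norm in y by 4 h^2 sum_j j^2 b_j^2, where b_j are the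
    coefficients of g ([integral_kappa_shift_le]).

    In the L^2 estimate this bound is itself a sum of exponentials.  In the L^1
    estimate its square root is needed, for b_j of size j^2 exp (- j^4 s), and
    integrating in time requires a linear substitute: for a nonincreasing
    sequence e, the square root of sum_j j^6 e_j^2 is at most
    2 sum_j j^(5/2) e_j ([sum_sqr_le_sqr_sum]).  Since j^(5/2) / j^4 is summable,
    no logarithm is left. *)

(** * Linear interpolation of the sine and the discrete eigenvalues *)

Lemma norm_mean_value_le (R : realType) (f df : R -> R) (x M : R) :
  (forall z, is_derive z (1 : R) f (df z)) ->
  (forall z, `|z| <= `|x| -> `|df z| <= M) -> `|f x - f 0| <= M * `|x|.
Proof.
move=> fd dM.
have cf (a b : R) : {within `[a, b], continuous f}.
  apply: continuous_subspaceT => z; apply/differentiable_continuous.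
  by apply/derivable1_diffP; exact: (@ex_derive _ _ _ _ _ _ _ (fd z)).
have [x0|x0] := leP 0 x.
- have [z /[!in_itv]/= /andP[z0 zx] ->] :=
    @MVT_segment R f df 0 x x0 _ (cf 0 x).
  rewrite subr0 normrM ler_wpM2r//; apply: dM.
  by rewrite !ger0_norm.
- have [z /[!in_itv]/= /andP[xz z0] E] :=
    @MVT_segment R f df x 0 (ltW x0) (fun z _ => fd z) (cf x 0).
  rewrite distrC E sub0r normrM normrN ler_wpM2r//; apply: dM.
  by rewrite (ler0_norm z0) ltr0_norm// lerN2.
Qed.

Lemma norm_sin_le (R : realType) (u : R) : `|sin u| <= `|u|.
Proof.
rewrite -[sin u]subr0 -(sin0 R) -[leRHS]mul1r.
apply: (@norm_mean_value_le R sin cos) => z _.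
by rewrite ler_norml cos_geN1 cos_le1.
Qed.

Lemma norm_cosB1_le (R : realType) (u : R) : `|cos u - 1| <= u ^+ 2 / 2.
Proof.
have -> : cos u - 1 = - (2 * sin (u / 2) ^+ 2).
  have {1}-> : u = u / 2 + u / 2 by lra.
  rewrite cosD -!expr2 cos2sin2; lra.
rewrite normrN ger0_norm; last by rewrite mulr_ge0// sqr_ge0.
have : `|sin (u / 2)| ^+ 2 <= `|u / 2| ^+ 2.
  by rewrite ler_sqr ?nnegrE//; exact: norm_sin_le.
rewrite !real_normK ?num_real//; lra.
Qed.

Lemma norm_sinB_le_of_cos (R : realType) (u M : R) :
  (forall z : R, `|z| <= `|u| -> `|cos z - 1| <= M) -> `|sin u - u| <= M * `|u|.
Proof.
move=> Mu.
have := @norm_mean_value_le R (fun z => sin z - z) (fun z => cos z - 1) u M _ Mu.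
by rewrite sin0 !subr0; apply=> z; apply: is_deriveB.
Qed.

Lemma norm_sinB_le_cube (R : realType) (u : R) : `|sin u - u| <= u ^+ 2 / 2 * `|u|.
Proof.
apply: norm_sinB_le_of_cos => z zu; apply: le_trans (norm_cosB1_le _ z) _.
rewrite ler_pM2r// -(real_normK (num_real z)) -(real_normK (num_real u)).
by rewrite ler_sqr ?nnegrE.
Qed.

Lemma norm_sinB_le_sqr (R : realType) (u : R) : `|sin u - u| <= u ^+ 2.
Proof.
rewrite -(real_normK (num_real u)) expr2.
apply: norm_sinB_le_of_cos => z zu; apply: le_trans zu.
have [z2|z2] := leP `|z| 2.
  apply: le_trans (norm_cosB1_le _ z) _; rewrite -(real_normK (num_real z)).
  have := normr_ge0 z; nra.
apply: le_trans (ltW z2); rewrite ler_norml.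
have := cos_geN1 z; have := cos_le1 z; lra.
Qed.

(** Splitting off [sin a] and [cos a] by the addition formula reduces the
    remainder at any point to those of [sin] and [cos] at 0. *)
Lemma norm_taylor_sin_le (R : realType) (a u : R) :
  `|sin (a + u) - sin a - u * cos a| <= 2 * u ^+ 2.
Proof.
have -> : sin (a + u) - sin a - u * cos a =
    sin a * (cos u - 1) + cos a * (sin u - u) by rewrite sinD; ring.
apply: le_trans (ler_normD _ _) _; rewrite !normrM.
have h (p q : R) : `|p| <= 1 -> `|p| * `|q| <= `|q|.
  by move=> p1; rewrite ler_piMl.
have hs : `|sin a| <= 1 by rewrite ler_norml sin_geN1 sin_le1.
have hc : `|cos a| <= 1 by rewrite ler_norml cos_geN1 cos_le1.
have := h _ (cos u - 1) hs; have := h _ (sin u - u) hc.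
have := norm_sinB_le_sqr _ u; have := norm_cosB1_le _ u; have := sqr_ge0 u; lra.
Qed.

(** The interpolation error is a combination of two first-order Taylor
    remainders at the same point, since interpolation is exact on affine functions. *)
Lemma norm_interp_sin_le (R : realType) (a d th : R) : 0 <= th <= 1 ->
  `|sin a + th * (sin (a + d) - sin a) - sin (a + th * d)| <= 4 * d ^+ 2.
Proof.
move=> /andP[th0 th1].
have -> : sin a + th * (sin (a + d) - sin a) - sin (a + th * d) =
   th * (sin (a + d) - sin a - d * cos a) -
   (sin (a + th * d) - sin a - th * d * cos a) by ring.
apply: le_trans (ler_normB _ _) _; rewrite normrM (ger0_norm th0).
have h1 := norm_taylor_sin_le _ a d; have h2 := norm_taylor_sin_le _ a (th * d).
have h3 := normr_ge0 (sin (a + d) - sin a - d * cos a).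
have : th * `|sin (a + d) - sin a - d * cos a| <= 2 * d ^+ 2.
  by apply: le_trans h1; rewrite ler_piMl.
have : (th * d) ^+ 2 <= d ^+ 2 by rewrite exprMn ler_piMl ?sqr_ge0// expr_le1.
lra.
Qed.

Lemma mesh_gt0 (R : realType) n : (0 < n)%N -> 0 < mesh R n.
Proof. by move=> n0; rewrite divr_gt0 ?pi_gt0 ?ltr0n. Qed.

Lemma sqrt_2pi_bnd (R : realType) : 0 <= Num.sqrt (2 / pi : R) <= 1.
Proof.
rewrite sqrtr_ge0 /= -[leRHS]sqrtr1 ler_wsqrtr//.
by rewrite ler_pdivrMr ?pi_gt0// mul1r pi_ge2.
Qed.

Lemma norm_phi_le1 (R : realType) j (x : R) : `|phi j x| <= 1.
Proof.
have /andP[s0 s1] := sqrt_2pi_bnd R.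
rewrite /phi normrM (ger0_norm s0) mulr_ile1//.
by rewrite ler_norml sin_geN1 sin_le1.
Qed.

(** With [th] the position of [x] inside its cell, this is the interpolation
    bound for the sine between two points at distance [j h]. *)
Lemma norm_phinB_le (R : realType) j n (x : R) : (0 < n)%N ->
  `|phin j n x - phi j x| <= 4 * (j%:R * mesh R n) ^+ 2.
Proof.
move=> n0; have h0 := mesh_gt0 R n n0.
have /andP[s0 s1] := sqrt_2pi_bnd R.
rewrite /phin; set k : R := (Num.floor (x / mesh R n))%:~R.
have -> : n%:R / pi * x = x / mesh R n by rewrite /mesh invf_div mulrC.
set th := x / mesh R n - k.
have th01 : 0 <= th <= 1.
  have /andP[] := real_floor_itv (num_real (x / mesh R n)).
  rewrite -/k intrD -/k /th; lra.
have xE : x = k * mesh R n + th * mesh R n.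
  by rewrite -mulrDl /th addrC subrK divfK// gt_eqF.
rewrite xE /phi.
have -> : j%:R * ((k + 1) * mesh R n) = j%:R * (k * mesh R n) + j%:R * mesh R n by ring.
have -> : j%:R * (k * mesh R n + th * mesh R n) =
  j%:R * (k * mesh R n) + th * (j%:R * mesh R n) by ring.
set a := j%:R * (k * mesh R n); set d := j%:R * mesh R n.
have -> : Num.sqrt (2 / pi) * sin a +
    th * (Num.sqrt (2 / pi) * sin (a + d) - Num.sqrt (2 / pi) * sin a) -
    Num.sqrt (2 / pi) * sin (a + th * d) =
  Num.sqrt (2 / pi) * (sin a + th * (sin (a + d) - sin a) - sin (a + th * d)) by ring.
rewrite normrM (ger0_norm s0).
by apply: le_trans (norm_interp_sin_le _ a d th th01); rewrite ler_piMl.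
Qed.

(** With [u = j pi / (2 n) <= 2] the factor is [(sin u / u) ^+ 2].  The cubic
    bound on [u - sin u] gives the closeness to 1; it is useless as a lower bound
    for [u] near 2, so the lower bound uses it at [u / 2] with the duplication
    formula. *)
Lemma cfactor_bnd (R : realType) j n : (0 < j < n)%N ->
  1 / 16 <= cfactor R j n <= 1 /\ 1 - cfactor R j n <= (j%:R * mesh R n) ^+ 2.
Proof.
move=> /andP[j0 jn]; have n0 : (0 < n)%N by apply: leq_trans jn.
rewrite /cfactor; set u := (j%:R * pi / (2 * n%:R) : R).
have uE : j%:R * mesh R n = 2 * u.
  by rewrite /u /mesh; field; rewrite pnatr_eq0 -lt0n.
have u0 : 0 < u by rewrite /u divr_gt0 ?mulr_gt0 ?pi_gt0 ?ltr0n.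
have u2 : u <= 2.
  have pi4 := pihalf_lt2 R.
  have -> : u = j%:R / n%:R * (pi / 2) by rewrite /u; field; rewrite pnatr_eq0 -lt0n.
  have jn1 : j%:R / n%:R <= 1 :> R.
    by rewrite ler_pdivrMr ?ltr0n// mul1r ler_nat ltnW.
  have := pi_gt0 R; have : 0 <= j%:R / n%:R :> R by rewrite divr_ge0.
  move: (j%:R / n%:R : R) jn1 pi4 => q q1 p4 q0 p0; nra.
rewrite uE -expr_div_n.
have hs : u * (1 - u ^+ 2 / 2) <= sin u <= u.
  have := norm_sinB_le_cube _ u; rewrite ler_norml (gtr0_norm u0).
  have := norm_sin_le _ u; rewrite (gtr0_norm u0) => /(le_trans (ler_norm _)).
  lra.
have hs2 : u / 4 <= sin u.
  have -> : sin u = 2 * sin (u / 2) * cos (u / 2).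
    have {1}-> : u = u / 2 + u / 2 by lra.
    rewrite sinD; ring.
  have := norm_sinB_le_cube _ (u / 2); rewrite ler_norml.
  have -> : `|u / 2| = u / 2 by rewrite gtr0_norm// divr_gt0.
  move=> /andP[s1 _].
  have := norm_cosB1_le _ (u / 2); rewrite ler_norml => /andP[c1 _].
  have h1 : u / 4 <= sin (u / 2) by move: s1; clear -u0 u2; nra.
  have h2 : 1 / 2 <= cos (u / 2) by move: c1; clear -u0 u2; nra.
  by clear -u0 h1 h2; nra.
have [q q1 q2] : exists2 q, q = sin u / u & (1 / 4 <= q <= 1) && (1 - u ^+ 2 / 2 <= q).
  exists (sin u / u) => //.
  by rewrite !ler_pdivlMr// ler_pdivrMr//; lra.
rewrite -q1; move: q2; clear; nra.
Qed.

(** * Error of the coefficients in one mode *)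

(** A common majorant of the exact and the discrete time factor of mode [j]:
    the discrete rate is at least [j^4 / 256], and half of it is spent to absorb
    a factor [j^4 s]. *)
Definition decay (R : realType) (j : nat) (s : R) : R :=
  expR (- (j%:R ^+ 4 * s / 512)).

(** The difference is [exp (- (c z)^2 s)] times [1 - exp (- (1 - c^2) z^2 s)],
    and the second factor is at most [(1 - c^2) z^2 s]; half of the exponential
    absorbs [z^2 s]. *)
Lemma expR_sub_le (R : realType) (z c s : R) : 0 <= s -> 1 / 16 <= c <= 1 ->
  0 <= expR (- ((c * z) ^+ 2 * s)) - expR (- (z ^+ 2 * s))
    <= 1024 * (1 - c) * expR (- (z ^+ 2 * s / 512)).
Proof.
move=> s0 /andP[c16 c1].
have w0 : 0 <= z ^+ 2 * s by rewrite mulr_ge0// sqr_ge0.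
have -> : (c * z) ^+ 2 * s = c ^+ 2 * (z ^+ 2 * s) by ring.
set w := z ^+ 2 * s in w0 *.
have /andP[c256 c21] : 1 / 256 <= c ^+ 2 <= 1 by nra.
apply/andP; split.
  by rewrite subr_ge0 ler_expR lerN2; nra.
have -> : expR (- w) = expR (- (c ^+ 2 * w)) * expR (- ((1 - c ^+ 2) * w)).
  by rewrite -expRD; congr expR; ring.
have -> : expR (- (c ^+ 2 * w)) = expR (- (c ^+ 2 * w / 2)) ^+ 2.
  by rewrite [RHS]expr2 -expRD; congr expR; lra.
have h1 : 1 - (1 - c ^+ 2) * w <= expR (- ((1 - c ^+ 2) * w)).
  exact: expR_ge1Dx.
have h2 : c ^+ 2 * w / 2 * expR (- (c ^+ 2 * w / 2)) <= 1.
  have := expR_ge1Dx (c ^+ 2 * w / 2) => /(fun h => le_trans _ h) H.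
  rewrite expRN ler_pdivrMr ?expR_gt0// mul1r; apply: H; lra.
have h3 : expR (- (c ^+ 2 * w / 2)) <= expR (- (w / 512)).
  rewrite ler_expR lerN2; nra.
have e0 := expR_gt0 (- (c ^+ 2 * w / 2)).
move: (expR (- (c ^+ 2 * w / 2))) e0 h2 h3 => E e0 h2 h3.
move: (expR (- ((1 - c ^+ 2) * w))) h1 => F h1.
have K0 : 0 <= 1024 * (1 - c) by lra.
apply: le_trans (ler_wpM2l K0 h3).
have : E ^+ 2 - E ^+ 2 * F <= E * ((1 - c ^+ 2) * (w * E)).
  have : E ^+ 2 * (1 - F) <= E ^+ 2 * ((1 - c ^+ 2) * w).
    by rewrite ler_wpM2l ?sqr_ge0//; lra.
  lra.
move/le_trans; apply; rewrite mulrC; apply: ler_wpM2r; first exact: ltW.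
have W0 : 0 <= w * E by rewrite mulr_ge0// ltW.
have wE : w * E <= 512 by have := ler_wpM2r W0 c256; lra.
have K1 : 0 <= 1 - c ^+ 2 by lra.
have := ler_wpM2l K1 wE.
have := sqr_ge0 (1 - c); lra.
Qed.

Lemma lamn_sqrE (R : realType) j n :
  lamn R j n ^+ 2 = (cfactor R j n * j%:R ^+ 2) ^+ 2.
Proof. rewrite /lamn; ring. Qed.

Lemma lam_sqrE (R : realType) j : lam R j ^+ 2 = (j%:R ^+ 2) ^+ 2.
Proof. rewrite /lam; ring. Qed.

Lemma expR_lam_le (R : realType) j (s : R) : 0 <= s ->
  expR (- (lam R j ^+ 2 * s)) <= decay R j s.
Proof.
move=> s0; rewrite ler_expR lerN2 lam_sqrE -exprM.
have : 0 <= j%:R ^+ 4 * s by rewrite mulr_ge0// exprn_ge0.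
have -> : (2 * 2 = 4)%N by []. lra.
Qed.

Lemma green_coef_le (R : realType) j n (x s : R) : (0 < j < n)%N -> 0 <= s ->
  `|expR (- (lamn R j n ^+ 2 * s)) * phin j n x -
    expR (- (lam R j ^+ 2 * s)) * phi j x|
  <= 1028 * (j%:R * mesh R n) ^+ 2 * decay R j s.
Proof.
move=> jn s0; have n0 : (0 < n)%N by case/andP: jn => ?; apply: leq_trans.
have [c01 c1] := cfactor_bnd R j n jn.
have /andP[d0 d1] := expR_sub_le R (j%:R ^+ 2) _ s s0 c01.
have eE : expR (- ((j%:R ^+ 2) ^+ 2 * s / 512)) = decay R j s.
  by rewrite /decay -exprM.
rewrite lamn_sqrE; rewrite eE -lam_sqrE in d0 d1 *.
move: d0 d1; set A := expR (- _); set B := expR (- _) => d0 d1.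
have e0 : 0 < decay R j s by exact: expR_gt0.
have A0 : 0 <= A by exact: expR_ge0.
have B0 : 0 <= B by exact: expR_ge0.
have Ae : A <= decay R j s.
  rewrite /A -eE ler_expR lerN2 exprMn -mulrA.
  have : 0 <= (j%:R ^+ 2) ^+ 2 * s by rewrite mulr_ge0// sqr_ge0.
  have : 1 / 256 <= cfactor R j n ^+ 2 by nra.
  move=> hp hq; have := ler_wpM2r hq hp; lra.
have -> : A * phin j n x - B * phi j x =
  A * (phin j n x - phi j x) + (A - B) * phi j x by ring.
apply: le_trans (ler_normD _ _) _.
rewrite (normrM A) (normrM (A - B)) (ger0_norm A0) (ger0_norm d0).
have hp := norm_phinB_le R j n x n0; have hq := norm_phi_le1 R j x.
have H1 : A * `|phin j n x - phi j x| <=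
    decay R j s * (4 * (j%:R * mesh R n) ^+ 2) by exact: ler_pM.
have H2 : (A - B) * `|phi j x| <= 1024 * (j%:R * mesh R n) ^+ 2 * decay R j s.
  apply: (@le_trans _ _ (A - B)); first by rewrite ler_piMr.
  apply: (le_trans d1); apply: ler_wpM2r; [exact: ltW|lra].
lra.
Qed.

Lemma lap_coef_le (R : realType) j n (x s : R) : (0 < j < n)%N -> 0 <= s ->
  `|lamn R j n * expR (- (lamn R j n ^+ 2 * s)) * phin j n x -
    lam R j * expR (- (lam R j ^+ 2 * s)) * phi j x|
  <= 1029 * j%:R ^+ 2 * (j%:R * mesh R n) ^+ 2 * decay R j s.
Proof.
move=> jn s0; have := green_coef_le R j n x s jn s0.
have := expR_lam_le R j s s0.
set P := expR _ * phin j n x; set e := expR (- (lam R j ^+ 2 * s)).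
have -> : lamn R j n * expR (- (lamn R j n ^+ 2 * s)) * phin j n x -
    lam R j * e * phi j x = lamn R j n * (P - e * phi j x) +
      (lamn R j n - lam R j) * (e * phi j x) by rewrite /P; ring.
have [c01 c1] := cfactor_bnd R j n jn.
move=> eD PD; apply: le_trans (ler_normD _ _) _.
rewrite (normrM (lamn R j n)) (normrM (lamn R j n - _)) (normrM e).
have j0 : 0 <= j%:R ^+ 2 :> R by rewrite sqr_ge0.
have hl : `|lamn R j n| <= j%:R ^+ 2.
  rewrite /lamn mulNr normrN ger0_norm; last by rewrite mulr_ge0//; lra.
  by rewrite ler_piMr//; lra.
have hd : `|lamn R j n - lam R j| <= j%:R ^+ 2 * (j%:R * mesh R n) ^+ 2.
  have -> : lamn R j n - lam R j = j%:R ^+ 2 * (1 - cfactor R j n).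
    by rewrite /lamn /lam; ring.
  rewrite ger0_norm; last by rewrite mulr_ge0//; lra.
  by rewrite ler_wpM2l.
have hq := norm_phi_le1 R j x.
have e0 : 0 <= e by exact: expR_ge0.
have H1 : `|lamn R j n| * `|P - e * phi j x| <=
    j%:R ^+ 2 * (1028 * (j%:R * mesh R n) ^+ 2 * decay R j s) by exact: ler_pM.
have H2 : `|e| * `|phi j x| <= decay R j s.
  by rewrite (ger0_norm e0); apply: le_trans eD; rewrite ler_piMr.
have H3 : `|lamn R j n - lam R j| * (`|e| * `|phi j x|) <=
    j%:R ^+ 2 * (j%:R * mesh R n) ^+ 2 * decay R j s.
  by apply: ler_pM => //; exact: mulr_ge0.
lra.
Qed.

(** * Discrete orthogonality and the shift to the grid *)

(** Multiplied by twice the sine of the half step, the sum telescopes, and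
    its end values differ by [m] full periods. *)
Lemma sum_cos_grid (R : realType) n m (th : R) : (0 < m < n.*2)%N ->
  \sum_(0 <= k < n.*2) cos (m%:R * (k%:R * mesh R n) + th) = 0.
Proof.
move=> /andP[m0 mn].
have n0 : (0 < n)%N by case: n mn.
have nR : (n%:R : R) != 0 by rewrite pnatr_eq0 -lt0n.
pose v : R := m%:R * mesh R n / 2.
have v0 : 0 < sin v.
  apply: sin_gt0_pi; apply/andP; split.
    by rewrite divr_gt0// mulr_gt0 ?mesh_gt0// ltr0n.
  rewrite /v /mesh mulrA ltr_pdivrMr// ltr_pdivrMr ?ltr0n//.
  rewrite mulrC -mulrA ltr_pM2l ?pi_gt0// -natrM ltr_nat.
  by rewrite mulnC muln2.
apply: (mulfI (lt0r_neq0 (mulr_gt0 (ltr0Sn R 1) v0))).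
rewrite mulr0 big_distrr/=.
(* The value of the sine half a step before the k-th point. *)
pose f k : R := sin (m%:R * mesh R n * k%:R - v + th).
rewrite (eq_big_nat _ _ (F2 := fun k => f k.+1 - f k)); last first.
  move=> k _; rewrite /f -[k.+1%:R]natr1.
  have -> : m%:R * mesh R n * (k%:R + 1) - v + th =
      (m%:R * (k%:R * mesh R n) + th) + v by rewrite /v; field.
  have -> : m%:R * mesh R n * k%:R - v + th =
      (m%:R * (k%:R * mesh R n) + th) - v by ring.
  by rewrite sinD sinB; ring.
rewrite telescope_sumr// /f mulr0 sub0r.
have -> : m%:R * mesh R n * n.*2%:R - v + th = (- v + th) + (pi *+ 2) *+ m.
  rewrite -muln2 natrM /mesh -[_ *+ m]mulr_natr -[pi *+ 2]mulr_natr; field.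
  exact: nR.
by rewrite (periodicn (@sinD2pi R)) subrr.
Qed.

Lemma sum_cos_cos_grid (R : realType) n j l (t u : R) :
  (0 < j < n)%N -> (0 < l < n)%N ->
  \sum_(0 <= k < n.*2) cos (j%:R * (k%:R * mesh R n) + t) *
                       cos (l%:R * (k%:R * mesh R n) + u) =
  if j == l then n%:R * cos (t - u) else 0.
Proof.
move=> /andP[j0 jn] /andP[l0 ln].
have cc (a b : R) : cos a * cos b = (cos (a + b) + cos (a - b)) / 2.
  by rewrite cosD cosB; field.
under eq_bigr do rewrite cc.
rewrite -big_distrl/= big_split/=.
have -> : \sum_(0 <= k < n.*2) cos (j%:R * (k%:R * mesh R n) + t +
     (l%:R * (k%:R * mesh R n) + u)) = 0.
  rewrite -[RHS](@sum_cos_grid R n (j + l) (t + u)); last first.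
    by rewrite addn_gt0 j0/= -addnn -addSn leq_add// ltnW.
  by apply: eq_bigr => k _; congr cos; rewrite natrD; ring.
rewrite add0r; have [<-|jl] := eqVneq j l.
  rewrite (eq_bigr (fun=> cos (t - u))); last first.
    by move=> k _; congr cos; ring.
  rewrite big_const_nat subn0 iter_addr_0 -[_ *+ n.*2]mulr_natr -[n.*2]muln2 natrM.
  by field.
have lt2 m : (m < n)%N -> (m < n.*2)%N.
  by move=> mn; rewrite -addnn; exact: ltn_addr.
have [lj|lj] := ltnP l j.
  rewrite -[RHS](mul0r (2^-1 : R)); congr (_ * _).
  rewrite -[RHS](@sum_cos_grid R n (j - l) (t - u)).
    by apply: eq_bigr => k _; congr cos; rewrite natrB ?(ltnW lj)//; ring.
  by rewrite subn_gt0 lj/= lt2// (leq_ltn_trans _ jn)// leq_subr.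
have {}lj : (j < l)%N by rewrite ltn_neqAle jl.
rewrite -[RHS](mul0r (2^-1 : R)); congr (_ * _).
rewrite -[RHS](@sum_cos_grid R n (l - j) (u - t)).
  by apply: eq_bigr => k _; rewrite -cosN; congr cos; rewrite natrB ?(ltnW lj)//; ring.
by rewrite subn_gt0 lj/= lt2// (leq_ltn_trans _ ln)// leq_subr.
Qed.

(** The phases may depend on the mode: only the diagonal terms survive, where
    the phases cancel.  The sum runs over a full period, twice the number of
    cells, because cosines are not orthogonal over half a period. *)
Lemma grid_parseval (R : realType) n (d th : nat -> R) :
  \sum_(0 <= k < n.*2)
    (\sum_(1 <= j < n) d j * cos (j%:R * (k%:R * mesh R n) + th j)) ^+ 2 =
  n%:R * \sum_(1 <= j < n) d j ^+ 2.
Proof.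
under eq_bigr => k _ do rewrite expr2 big_distrlr /=.
rewrite exchange_big/= big_distrr/=; apply: eq_big_nat => j jn.
rewrite exchange_big/= (eq_big_nat _ _
    (F2 := fun l => if l == j then n%:R * d j ^+ 2 else 0)).
  by rewrite -big_mkcond/= big_nat1_eq jn.
move=> l ln; rewrite (eq_bigr (fun k => d j * d l *
    (cos (j%:R * (k%:R * mesh R n) + th j) *
     cos (l%:R * (k%:R * mesh R n) + th l)))); last by move=> k _; ring.
rewrite -big_distrr/= sum_cos_cos_grid// eq_sym.
case: eqVneq => [->|_]; last by rewrite mulr0.
by rewrite subrr cos0; ring.
Qed.

(** A difference of sines is a product, so mode [j] contributes a cosine in [k]
    with amplitude proportional to [sin (j r / 2)], of order [j h].  The sum over
    the [n] cells is enlarged to a full period. *)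
Lemma grid_shift_le (R : realType) n (b : nat -> R) (r : R) :
  0 <= r <= mesh R n ->
  \sum_(0 <= k < n)
    (\sum_(1 <= j < n) b j * phi j (k%:R * mesh R n) -
     \sum_(1 <= j < n) b j * phi j (k%:R * mesh R n + r)) ^+ 2
  <= n%:R * mesh R n ^+ 2 * \sum_(1 <= j < n) b j ^+ 2 * j%:R ^+ 2.
Proof.
move=> /andP[r0 rh].
pose d j : R := - 2 * Num.sqrt (2 / pi) * b j * sin (j%:R * r / 2).
pose th j : R := j%:R * r / 2.
pose F k : R := \sum_(1 <= j < n) d j * cos (j%:R * (k%:R * mesh R n) + th j).
rewrite (eq_bigr (fun k => F k ^+ 2)); last first.
  move=> k _; congr (_ ^+ 2); rewrite /F -sumrB; apply: eq_bigr => j _.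
  rewrite /phi /d -/(th j).
  have -> : j%:R * (k%:R * mesh R n + r) =
    (j%:R * (k%:R * mesh R n) + th j) + th j by rewrite /th; field.
  have {1}-> : j%:R * (k%:R * mesh R n) =
    (j%:R * (k%:R * mesh R n) + th j) - th j by ring.
  move: (_ + th j) => A.
  rewrite sinB sinD; ring.
apply: (@le_trans _ _ (\sum_(0 <= k < n.*2) F k ^+ 2)).
  have n2 : (n <= n.*2)%N by rewrite -addnn leq_addr.
  rewrite [leRHS](big_cat_nat (leq0n n) n2)/=.
  by rewrite lerDl sumr_ge0// => k _; rewrite sqr_ge0.
rewrite grid_parseval -mulrA ler_wpM2l// big_distrr/=.
apply: ler_sum => j _; rewrite /d.
have sq : Num.sqrt (2 / pi : R) ^+ 2 <= 1.
  by have /andP[s0 s1] := sqrt_2pi_bnd R; rewrite expr_le1.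
have ss : sin (j%:R * r / 2) ^+ 2 <= (j%:R * r / 2) ^+ 2.
  rewrite -(real_normK (num_real (sin _))) -(real_normK (num_real (_ / 2))).
  by rewrite ler_sqr ?nnegrE// norm_sin_le.
have rr : r ^+ 2 <= mesh R n ^+ 2 by rewrite ler_sqr ?nnegrE// (le_trans r0).
have b0 : 0 <= 4 * b j ^+ 2 by rewrite mulr_ge0// sqr_ge0.
have st0 : sin (j%:R * r / 2) ^+ 2 <= (j%:R * mesh R n / 2) ^+ 2.
  apply: le_trans ss _; have := ler_wpM2l (sqr_ge0 (j%:R : R)) rr; lra.
have st : Num.sqrt (2 / pi : R) ^+ 2 * sin (j%:R * r / 2) ^+ 2 <=
    1 * (j%:R * mesh R n / 2) ^+ 2.
  by apply: ler_pM => //; exact: sqr_ge0.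
have := ler_wpM2l b0 st; lra.
Qed.

(** * Inequalities for finite sums *)

(** Comparison with the telescoping sum of [2 / j - 2 / (j + 1)]. *)
Lemma sum_inv_sqr_le (R : realType) n N : (0 < n)%N ->
  \sum_(n <= j < N) (j%:R ^- 2 : R) <= 2 / n%:R.
Proof.
move=> n0; have [nN|Nn] := leqP n N; last first.
  by rewrite big_geq ?(ltnW Nn)// divr_ge0.
apply: (@le_trans _ _ (\sum_(n <= j < N) (- (2 / j.+1%:R) - - (2 / j%:R) : R))).
  apply: ler_sum_nat => j /andP[nj _].
  have j1 : 1 <= j%:R :> R by rewrite ler1n (leq_trans n0).
  rewrite -[j.+1%:R]natr1; have -> : - (2 / (j%:R + 1)) - - (2 / j%:R) =
      2 / (j%:R * (j%:R + 1)) :> R by field; lra.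
  rewrite -exprVn -[leLHS]mul1r exprVn ler_pdivrMr ?exprn_gt0//; last lra.
  rewrite mulrAC ler_pdivlMr; last by rewrite mulr_gt0; lra.
  nra.
rewrite telescope_sumr// opprK addrC gerDl oppr_le0.
by rewrite divr_ge0.
Qed.

(** The terms are [j^(- 3/2)]; comparison with the telescoping sum of
    [4 / sqrt j - 4 / sqrt (j + 1)]. *)
Lemma sum_inv_sqrt3_le (R : realType) N :
  \sum_(1 <= j < N) (Num.sqrt j%:R / j%:R ^+ 2 : R) <= 4.
Proof.
have [N1|N1] := leqP 1 N; last by rewrite big_geq ?(ltnW N1).
pose f j : R := - (4 / Num.sqrt j%:R).
apply: (@le_trans _ _ (\sum_(1 <= j < N) (f j.+1 - f j))).
  apply: ler_sum_nat => j /andP[j1 _].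
  have aE : (j%:R : R) = Num.sqrt j%:R ^+ 2 by rewrite sqr_sqrtr.
  have bE : Num.sqrt j.+1%:R ^+ 2 = Num.sqrt j%:R ^+ 2 + 1 :> R.
    by rewrite !sqr_sqrtr// natr1.
  have a1 : 1 <= Num.sqrt j%:R :> R by rewrite -[leLHS]sqrtr1 ler_wsqrtr// ler1n.
  have b0 : 0 <= Num.sqrt j.+1%:R :> R by exact: sqrtr_ge0.
  rewrite /f [X in _ / X ^+ 2]aE.
  move: (Num.sqrt j%:R) (Num.sqrt j.+1%:R) bE a1 b0 => a b bE a1 b0.
  have ab : a <= b by nra.
  have b1 : b <= a + 1 by nra.
  have -> : - (4 / b) - - (4 / a) = 4 * (b - a) / (a * b) by field; lra.
  have -> : a / (a ^+ 2) ^+ 2 = 1 / a ^+ 3 by field; lra.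
  rewrite ler_pdivrMr ?exprn_gt0//; last lra.
  rewrite mulrAC ler_pdivlMr; last by rewrite mulr_gt0; lra.
  rewrite mul1r.
  have ba1 : (b - a) * (b + a) = 1 by rewrite -subr_sqr bE; ring.
  have h : b * (b + a) <= 4 * a ^+ 2 by have := sqr_ge0 (b - a); nra.
  have K0 : 0 <= (b - a) * a by apply: mulr_ge0; lra.
  have := ler_wpM2l K0 h.
  have -> : (b - a) * a * (b * (b + a)) = a * b * ((b - a) * (b + a)) by ring.
  rewrite ba1; lra.
rewrite telescope_sumr// /f sqrtr1 divr1 opprK addrC gerDl oppr_le0.
by rewrite divr_ge0// sqrtr_ge0.
Qed.

(** The discrete form of integrating [x^(5/2)]: consecutive values of [N^(7/2)]
    differ by at most [4 N^(5/2)]. *)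
Lemma pow7_2_le_sum (R : realType) N :
  N%:R ^+ 3 * Num.sqrt N%:R <=
  4 * \sum_(1 <= j < N.+1) (j%:R ^+ 2 * Num.sqrt j%:R : R).
Proof.
elim: N => [|N IH]; first by rewrite big_geq// expr0n mul0r mulr0.
rewrite big_nat_recr//= mulrDr; apply: le_trans (lerD IH (lexx _)).
have a0 : 0 <= Num.sqrt N%:R :> R by exact: sqrtr_ge0.
have b1 : 1 <= Num.sqrt N.+1%:R :> R by rewrite -[leLHS]sqrtr1 ler_wsqrtr// ler1n.
have aE : N%:R = Num.sqrt N%:R ^+ 2 :> R by rewrite sqr_sqrtr.
have bE : N.+1%:R = Num.sqrt N.+1%:R ^+ 2 :> R by rewrite sqr_sqrtr.
have ba : Num.sqrt N.+1%:R ^+ 2 = Num.sqrt N%:R ^+ 2 + 1 :> R by rewrite -aE -bE natr1.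
rewrite [X in X ^+ 3 * _]bE [X in X ^+ 2 * _]bE [X in X ^+ 3 * _ + _]aE.
move: (Num.sqrt N%:R) (Num.sqrt N.+1%:R) ba a0 b1 => a b ba a0 b1.
have ab : a <= b by nra.
have b0 : 0 < b by lra.
rewrite -(ler_pM2r b0).
have X0 : 0 <= a ^+ 2 by exact: sqr_ge0.
have h : (a ^+ 2) ^+ 3 * a * a <= (a ^+ 2) ^+ 3 * a * b.
  by apply: ler_wpM2l => //; rewrite mulr_ge0// exprn_ge0.
have -> : (b ^+ 2) ^+ 3 * b * b = (b ^+ 2) ^+ 4 by ring.
have -> : ((a ^+ 2) ^+ 3 * a + 4 * ((b ^+ 2) ^+ 2 * b)) * b =
  (a ^+ 2) ^+ 3 * a * b + 4 * (b ^+ 2) ^+ 3 by ring.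
apply: le_trans (lerD h (lexx _)).
have -> : (a ^+ 2) ^+ 3 * a * a = (a ^+ 2) ^+ 4 by ring.
rewrite ba; move: (a ^+ 2) X0 => X X0; have := sqr_ge0 X; lra.
Qed.

(** Linearizes a quadratic mean.  When the term [u] of index [N] is added, the
    square on the right grows by at least [u] times the new sum; as [e] is
    nonincreasing, this sum is at least [e N] times the sum of [j^(5/2)], that is
    a multiple of [N^(7/2) e N]. *)
Lemma sum_sqr_le_sqr_sum (R : realType) (e : nat -> R) N :
  (forall j, 0 <= e j) -> (forall j, e j.+1 <= e j) ->
  \sum_(1 <= j < N) j%:R ^+ 6 * e j ^+ 2 <=
  4 * (\sum_(1 <= j < N) j%:R ^+ 2 * Num.sqrt j%:R * e j) ^+ 2.
Proof.
move=> e0 eS; elim: N => [|N IH]; first by rewrite !big_geq// expr0n mulr0.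
have [->|N0] := posnP N; first by rewrite !big_geq// expr0n mulr0.
rewrite !(big_nat_recr N)//=.
set U := \sum_(1 <= i < N) i%:R ^+ 2 * Num.sqrt i%:R * e i in IH *.
set u := N%:R ^+ 2 * _ * _.
have ndec j k : (j <= k)%N -> e k <= e j.
  move=> /subnKC <-; elim: (k - j)%N => [|m]; first by rewrite addn0.
  by rewrite addnS; apply: le_trans.
have U0 : 0 <= U by rewrite sumr_ge0// => j _; rewrite !mulr_ge0// sqrtr_ge0.
have u0 : 0 <= u by rewrite !mulr_ge0// sqrtr_ge0.
have Uu : N%:R ^+ 3 * Num.sqrt N%:R * e N <= 4 * (U + u).
  have := ler_wpM2r (e0 N) (pow7_2_le_sum R N).
  move=> /le_trans; apply; rewrite -mulrA ler_wpM2l//.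
  rewrite big_nat_recr//= mulrDl lerD2r big_distrl/=.
  apply: ler_sum_nat => j /andP[_ jN].
  by rewrite ler_wpM2l ?mulr_ge0 ?sqrtr_ge0// ndec// ltnW.
have E : N%:R ^+ 6 * e N ^+ 2 = u * (N%:R ^+ 3 * Num.sqrt N%:R * e N).
  have -> : u * (N%:R ^+ 3 * Num.sqrt N%:R * e N) =
    N%:R ^+ 5 * Num.sqrt N%:R ^+ 2 * e N ^+ 2 by rewrite /u; ring.
  by rewrite sqr_sqrtr// -exprSr.
rewrite E; have := ler_wpM2l u0 Uu; nra.
Qed.

Lemma cauchy_schwarz_sum (R : realType) (a b : nat -> R) n N :
  (\sum_(n <= j < N) a j * b j) ^+ 2 <=
  (\sum_(n <= j < N) a j ^+ 2) * (\sum_(n <= j < N) b j ^+ 2).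
Proof.
elim: N => [|N IH]; first by rewrite !big_geq// expr0n mul0r.
have [nN|Nn] := leqP n N; last by rewrite !big_geq// expr0n mul0r.
rewrite !(big_nat_recr N)//=; move: IH.
set A := \sum_(n <= j < N) a j * b j.
have P0 : 0 <= \sum_(n <= j < N) a j ^+ 2 by apply: sumr_ge0 => j _; exact: sqr_ge0.
have Q0 : 0 <= \sum_(n <= j < N) b j ^+ 2 by apply: sumr_ge0 => j _; exact: sqr_ge0.
move: (\sum_(n <= j < N) a j ^+ 2) (\sum_(n <= j < N) b j ^+ 2) P0 Q0 A (a N) (b N).
move=> P Q P0 Q0 A x y APQ.
have h0 : 0 <= P * y ^+ 2 + Q * x ^+ 2 by rewrite addr_ge0// mulr_ge0// sqr_ge0.
suff : 2 * A * (x * y) <= P * y ^+ 2 + Q * x ^+ 2 by lra.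
apply: le_trans (ler_norm _) _; rewrite -ler_sqr ?nnegrE// real_normK ?num_real//.
have := ler_wpM2r (sqr_ge0 (x * y)) APQ.
have := sqr_ge0 (P * y ^+ 2 - Q * x ^+ 2); lra.
Qed.

(** * Integration over the cells of the grid *)

(** The integral of a nonnegative function is a supremum over the simple
    functions below it, hence monotone on arbitrary functions.  This is used for the
    inner integrals, which as functions of time come without measurability. *)
Lemma le_integral_nonneg (d : measure_display) (T : measurableType d)
    (R : realType) (mu : {measure set T -> \bar R}) (D : set T)
    (f g : T -> \bar R) :
  (forall x, D x -> 0 <= f x)%E -> (forall x, D x -> f x <= g x)%E ->
  (\int[mu]_(x in D) f x <= \int[mu]_(x in D) g x)%E.
Proof.
move=> f0 fg; have g0 x : D x -> (0 <= g x)%E.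
  by move=> Dx; exact: le_trans (f0 x Dx) (fg x Dx).
rewrite !ge0_integralE//; apply: le_ereal_sup => _ [h hf <-].
exists h => // x; apply: le_trans (hf x) _.
exact: lee_restrict.
Qed.

Lemma lebesgue_measure_shift (R : realType) (a : R) (A : set R) : measurable A ->
  pushforward lebesgue_measure ((+%R a) : _ -> measurableTypeR R) A =
  lebesgue_measure A.
Proof.
move=> mA; apply/esym/lebesgue_measure_unique => //=.
  exact: measurable_funD.
move=> _ _ [[b c]] _ <-.
rewrite /pushforward/=.
have -> : (+%R a) @^-1` `]b, c] = `]b - a, c - a]%classic.
  apply/seteqP; split => x /=; rewrite !in_itv/= => /andP[h1 h2]; apply/andP; split; lra.
rewrite !lebesgue_measure_itv/= !lte_fin ltrD2r; case: ifP => // _.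
by rewrite -!EFinB; congr EFin; ring.
Qed.

Lemma ge0_integral_shift (R : realType) (a b c : R) (f : R -> \bar R) :
  measurable_fun setT f -> (forall x, 0 <= f x)%E ->
  (\int[lebesgue_measure]_(x in `[(a + b)%R, (a + c)%R[) f x =
   \int[lebesgue_measure]_(x in `[b, c[) f (a + x)%R)%E.
Proof.
move=> mf f0.
rewrite (_ : `[b, c[%classic =
    ((+%R a) : _ -> measurableTypeR R) @^-1` `[(a + b)%R, (a + c)%R[); last first.
  by apply/seteqP; split => x /=; rewrite !in_itv/= => /andP[h1 h2];
    apply/andP; split; lra.
have ma : measurable_fun setT ((+%R a) : measurableTypeR R -> measurableTypeR R).
  exact: measurable_funD.
rewrite -ge0_integral_pushforward//=; last exact: measurable_funS mf.
by apply: eq_measure_integral => //= B mB BS; exact/esym/lebesgue_measure_shift.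
Qed.

Lemma ge0_integral_cells (R : realType) (h : R) (m : nat) (f : R -> \bar R) :
  0 < h -> measurable_fun setT f -> (forall x, 0 <= f x)%E ->
  (\int[lebesgue_measure]_(x in `[0%R, (m%:R * h)%R[) f x =
   \sum_(0 <= k < m) \int[lebesgue_measure]_(r in `[0%R, h[) f (k%:R * h + r)%R)%E.
Proof.
move=> h0 mf f0; elim: m => [|m IH].
  by rewrite mul0r set_itvco0 integral_set0 big_geq.
rewrite big_nat_recr//= -IH -[X in (_ = _ + X)%E]ge0_integral_shift//.
have mh : m%:R * h <= m%:R * h + h by rewrite lerDl ltW.
rewrite -natr1 mulrDl mul1r addr0.
rewrite (@itv_bndbnd_setU _ _ (BLeft 0) (BLeft (m%:R * h))
  (BLeft (m%:R * h + h))); last 2 first.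
- by rewrite bnd_simp mulr_ge0// ltW.
- by rewrite bnd_simp.
rewrite ge0_integral_setU//.
- exact: measurable_funS mf.
- apply/disj_set2P/seteqP; split => // x /= []; rewrite !in_itv/=.
  by move=> /andP[_ h1] /andP[h2 _]; move: (lt_le_trans h1 h2); rewrite ltxx.
Qed.

Lemma kappa_cell (R : realType) n k (r : R) : (0 < n)%N ->
  0 <= r < mesh R n -> kappa n (k%:R * mesh R n + r) = k%:R * mesh R n.
Proof.
move=> n0 /andP[r0 rh]; have h0 := mesh_gt0 R n n0.
rewrite /kappa mulrC; congr (_ * _).
suff -> : Num.floor ((k%:R * mesh R n + r) / mesh R n) = k%:Z by rewrite -pmulrn.
apply: floor_def; rewrite ler_pdivlMr// ltr_pdivrMr// intrD -!pmulrn.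
by rewrite mulrDl mul1r lerDl ltrD2l r0.
Qed.

Lemma measurable_phi (R : realType) j : measurable_fun setT (@phi R j).
Proof.
rewrite /phi; apply: measurable_funM; first exact: measurable_cst.
apply: (measurableT_comp (continuous_measurable_fun (@continuous_sin R))).
exact: mulrl_measurable.
Qed.

Lemma measurable_kappa (R : realType) n : (0 < n)%N ->
  measurable_fun setT (@kappa R n).
Proof.
move=> n0; have h0 := mesh_gt0 R n n0.
apply: nondecreasing_measurable => // x y xy.
rewrite /kappa ler_pM2l// ler_int; apply: le_floor.
by rewrite ler_pM2r// invr_gt0.
Qed.

Lemma measurable_kappa_shift (R : realType) n (b : nat -> R) : (0 < n)%N ->
  measurable_fun setT (fun y : R => \sum_(1 <= j < n) b j * phi j (kappa n y) -
    \sum_(1 <= j < n) b j * phi j y).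
Proof.
move=> n0.
have mg : measurable_fun setT (fun y : R => \sum_(1 <= j < n) b j * phi j y).
  apply: measurable_sum => j; apply: measurable_funM => //; exact: measurable_phi.
apply: measurable_funB => //.
exact: (measurableT_comp mg (measurable_kappa R n n0)).
Qed.

(** Folded onto one cell, the integrand becomes at each offset [r] the sum over
    the cells bounded in [grid_shift_le]; then [h n = pi <= 4]. *)
Lemma integral_kappa_shift_le (R : realType) n (b : nat -> R) : (0 < n)%N ->
  (\int[@lebesgue_measure R]_(y in `]0%R, pi[)
     ((\sum_(1 <= j < n) b j * phi j (kappa n y) -
       \sum_(1 <= j < n) b j * phi j y) ^+ 2)%:E
   <= (4 * mesh R n ^+ 2 * \sum_(1 <= j < n) b j ^+ 2 * j%:R ^+ 2)%:E)%E.
Proof.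
move=> n0; have h0 := mesh_gt0 R n n0.
have nh : n%:R * mesh R n = pi by rewrite /mesh mulrCA divff ?mulr1// pnatr_eq0 -lt0n.
set S := \sum_(1 <= j < n) b j ^+ 2 * _.
have S0 : 0 <= S by apply: sumr_ge0 => j _; rewrite mulr_ge0// sqr_ge0.
set F := fun y : R => ((\sum_(1 <= j < n) b j * phi j (kappa n y) -
       \sum_(1 <= j < n) b j * phi j y) ^+ 2)%:E.
have mF : measurable_fun setT F.
  by apply/measurable_EFinP; apply: measurable_funX; exact: measurable_kappa_shift.
have F0 y : (0 <= F y)%E by rewrite lee_fin sqr_ge0.
apply: (@le_trans _ _ (\int[lebesgue_measure]_(y in `[0%R, (n%:R * mesh R n)%R[) F y)%E).
  apply: ge0_subset_integral => //; first exact: measurable_funS mF.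
    by move=> y _; exact: F0.
  by move=> y /=; rewrite nh !in_itv/= => /andP[/ltW -> ->].
rewrite ge0_integral_cells//.
rewrite -ge0_integral_sum//; last first.
  move=> k; apply: measurable_funTS; apply: (measurableT_comp mF).
  exact: measurable_funD.
apply: (@le_trans _ _ (\int[lebesgue_measure]_(r in `[0%R, mesh R n[)
    (cst (n%:R * mesh R n ^+ 2 * S)%:E r))%E).
  apply: le_integral_nonneg => [r _|r]; first exact: sume_ge0.
  rewrite /= in_itv/= => /andP[r0 rh].
  under eq_bigr => k _ do rewrite /F (kappa_cell R n k r n0) ?r0//.
  by rewrite sumEFin lee_fin grid_shift_le// r0 ltW.
rewrite integral_cst//= lebesgue_measure_itv/= lte_fin h0 oppr0 -EFinD addr0.
rewrite -EFinM lee_fin.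
have -> : n%:R * mesh R n ^+ 2 * S * mesh R n = pi * (mesh R n ^+ 2 * S).
  by rewrite -nh; ring.
rewrite -mulrA ler_wpM2r//; first by rewrite mulr_ge0// sqr_ge0.
have := pihalf_lt2 R; lra.
Qed.

(** The form in which both estimates use the shift error: a pointwise majorant
    of the kernel error that is affine in the square of the shift error. *)
Lemma integral_affine_kappa_shift_le (R : realType) n (b : nat -> R) (c m : R) :
  (0 < n)%N -> 0 <= c -> 0 <= m ->
  (\int[@lebesgue_measure R]_(y in `]0%R, pi[)
     (c + m * (\sum_(1 <= j < n) b j * phi j (kappa n y) -
       \sum_(1 <= j < n) b j * phi j y) ^+ 2)%:E
   <= (4 * c + m * (4 * mesh R n ^+ 2 * \sum_(1 <= j < n) b j ^+ 2 * j%:R ^+ 2))%:E)%E.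
Proof.
move=> n0 c0 m0; have mB := measurable_kappa_shift R n b n0.
under eq_integral do rewrite EFinD EFinM.
rewrite ge0_integralD//; first last.
- apply: measurable_funeM; apply/measurable_EFinP; apply: measurable_funX.
  exact: measurable_funTS mB.
- by move=> y _; rewrite -EFinM lee_fin mulr_ge0// sqr_ge0.
rewrite ge0_integralZl//; first last.
- by move=> y _; rewrite lee_fin sqr_ge0.
- apply/measurable_EFinP; apply: measurable_funX; exact: measurable_funTS mB.
rewrite EFinD EFinM; apply: leeD.
  rewrite integral_cst//= lebesgue_measure_itv/= lte_fin pi_gt0 oppr0 -EFinD addr0.
  rewrite -EFinM lee_fin mulrC; apply: ler_wpM2r => //.
  have := pihalf_lt2 R; lra.
by rewrite EFinM lee_wpmul2l ?lee_fin// integral_kappa_shift_le.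
Qed.

(** * Series of exponentials in time *)

Lemma integral_decay_le (R : realType) j (t : R) : (0 < j)%N ->
  (\int[@lebesgue_measure R]_(s in `]0%R, t[) (decay R j s)%:E
   <= (512 / j%:R ^+ 4)%:E)%E.
Proof.
move=> j0; pose r : R := j%:R ^+ 4 / 512.
have r0 : 0 < r by rewrite divr_gt0 ?exprn_gt0 ?ltr0n.
have mp : measurable_fun setT (EFin \o exponential_pdf r).
  by apply/measurable_EFinP; exact: measurable_exponential_pdf.
have p0 x : (0 <= (exponential_pdf r x)%:E)%E.
  by rewrite lee_fin exponential_pdf_ge0// ltW.
have -> : (\int[@lebesgue_measure R]_(s in `]0%R, t[) (decay R j s)%:E =
    \int[@lebesgue_measure R]_(s in `]0%R, t[)
      ((r^-1)%:E * (exponential_pdf r s)%:E))%E.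
  apply: eq_integral => s; rewrite inE/= in_itv/= => /andP[s0 _].
  rewrite exponential_pdfE ?ltW// -EFinM mulKf ?gt_eqF//.
  by congr (EFin (expR _)); rewrite /r; field.
rewrite ge0_integralZl//; [|exact: measurable_funS mp|by rewrite lee_fin invr_ge0 ltW].
apply: (@le_trans _ _
  ((r^-1)%:E * \int[@lebesgue_measure R]_s (exponential_pdf r s)%:E)%E).
  apply: lee_wpmul2l; first by rewrite lee_fin invr_ge0 ltW.
  exact: ge0_subset_integral.
by rewrite integral_exponential_pdf// mule1 /r invf_div.
Qed.

Lemma measurable_decay (R : realType) j : measurable_fun setT (decay R j).
Proof.
apply: (measurableT_comp (@measurable_expR R)).
apply: measurableT_comp => //; apply: measurable_funM => //.
Qed.

(** Mode 0 does not decay, hence [w 0 = 0]; the series starts at 0 to match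
    termwise integration. *)
Lemma integral_weighted_decay_le (R : realType) (w : nat -> R) (t M : R) :
  (forall j, 0 <= w j) -> w 0 = 0 ->
  (forall N, \sum_(1 <= j < N) w j * (512 / j%:R ^+ 4) <= M) ->
  (\int[@lebesgue_measure R]_(s in `]0%R, t[)
     \sum_(0 <= j <oo) (w j * decay R j s)%:E <= M%:E)%E.
Proof.
move=> w0 w00 wM.
have mw j : measurable_fun `]0, t[%classic (fun s => (w j * decay R j s)%:E).
  apply/measurable_EFinP; apply: measurable_funM => //.
  exact: measurable_funTS (measurable_decay R j).
have p0 j s : (0 <= (w j * decay R j s)%:E)%E by rewrite lee_fin mulr_ge0// expR_ge0.
rewrite integral_nneseries//; apply: lime_le.
  by apply: is_cvg_nneseries => j _ _; exact: integral_ge0.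
apply: nearW => -[|N].
  by rewrite big_geq// lee_fin; have := wM 0%N; rewrite big_geq.
apply: (@le_trans _ _ (\sum_(1 <= j < N.+1) w j * (512 / j%:R ^+ 4))%:E); last first.
  by rewrite lee_fin.
rewrite big_nat_recl//= w00.
under [X in (X + _)%E]eq_integral do rewrite mul0r.
rewrite integral0 add0e big_add1/= -sumEFin.
apply: lee_sum => j _.
under eq_integral do rewrite EFinM.
rewrite ge0_integralZl//; first last.
- by rewrite lee_fin.
- by move=> s _; rewrite lee_fin expR_ge0.
- by apply/measurable_EFinP; exact: measurable_funTS (measurable_decay R j.+1).
by rewrite EFinM lee_wpmul2l ?lee_fin// integral_decay_le.
Qed.

(** From [exp (- u) <= 1 / u]: it makes the series with weights [j^2]
    converge like the sum of [1 / j^2] at each positive time. *)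
Lemma decay_le_inv (R : realType) j (s : R) : (0 < j)%N -> 0 < s ->
  decay R j s <= 512 / s * j%:R ^- 4.
Proof.
move=> j0 s0; have j4 : 0 < j%:R ^+ 4 :> R by rewrite exprn_gt0// ltr0n.
set u : R := j%:R ^+ 4 * s / 512.
have u0 : 0 < u by apply: divr_gt0; [exact: mulr_gt0|rewrite ltr0n].
have -> : 512 / s * j%:R ^- 4 = u^-1.
  by rewrite /u; field; rewrite !gt_eqF// ltr0n.
rewrite /decay -/u expRN lef_pV2 ?posrE ?expR_gt0//.
have := expR_ge1Dx u; lra.
Qed.

Lemma sum_weighted_decay_le (R : realType) (w : nat -> R) (c s : R) n N :
  0 < s -> (0 < n)%N -> (forall j, (n <= j)%N -> 0 <= w j <= c * j%:R ^+ 2) ->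
  \sum_(n <= j < N) w j * decay R j s <= c * (512 / s) * 2.
Proof.
move=> s0 n0 wc.
have c0 : 0 <= c.
  have /andP[h1 h2] := wc n (leqnn n).
  have n2 : 0 < n%:R ^+ 2 :> R by rewrite exprn_gt0// ltr0n.
  by rewrite -(pmulr_lge0 c n2) (le_trans h1 h2).
have C0 : 0 <= c * (512 / s).
  by apply: mulr_ge0; [exact: c0|apply: divr_ge0; [exact: ler0n|exact: ltW]].
apply: (@le_trans _ _ (\sum_(n <= j < N) c * (512 / s) * j%:R ^- 2)).
  apply: ler_sum_nat => j /andP[nj _]; have /andP[w0 w1] := wc j nj.
  have j0 : (0 < j)%N by apply: leq_trans nj.
  have -> : c * (512 / s) * j%:R ^- 2 = (c * j%:R ^+ 2) * (512 / s * j%:R ^- 4).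
    by field; rewrite !gt_eqF// ltr0n.
  by apply: ler_pM => //; [exact: expR_ge0|exact: decay_le_inv].
rewrite -big_distrr/=; apply: ler_wpM2l => //.
apply: le_trans (sum_inv_sqr_le R n N n0) _.
by rewrite ler_pdivrMr ?ltr0n// ler_peMr// ler1n.
Qed.

Lemma weighted_decay_total (R : realType) (w : nat -> R) (c s : R) : 0 < s ->
  w 0 = 0 -> (forall j, 0 <= w j <= c * j%:R ^+ 2) ->
  exists2 tau : R, (forall N, \sum_(1 <= j < N) w j * decay R j s <= tau) &
    (\sum_(0 <= j <oo) (w j * decay R j s)%:E = tau%:E)%E.
Proof.
move=> s0 w00 wc; pose u N : R := \sum_(0 <= j < N) w j * decay R j s.
have p0 j : 0 <= w j * decay R j s.
  by have /andP[h _] := wc j; rewrite mulr_ge0// expR_ge0.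
have u1 N : \sum_(1 <= j < N) w j * decay R j s <= u N.
  rewrite /u; case: N => [|N]; first by rewrite !big_geq.
  by rewrite [leRHS]big_ltn// w00 mul0r add0r.
have [K uK] : exists K, forall N, \sum_(1 <= j < N) w j * decay R j s <= K.
  exists (c * (512 / s) * 2) => N.
  by apply: sum_weighted_decay_le => // j _; exact: wc.
have nu : nondecreasing_seq u.
  apply/nondecreasing_seqP => N; rewrite /u big_nat_recr//= lerDl; exact: p0.
have cu : cvgn u.
  apply: nondecreasing_is_cvgn => //; exists K => _ [N _ <-].
  rewrite /u; case: N => [|N].
    by have := uK 0%N; rewrite !big_geq.
  by rewrite big_ltn// w00 mul0r add0r.
exists (limn u).
  by move=> N; apply: le_trans (u1 N) _; exact: nondecreasing_cvgn_le.
rewrite -EFin_lim//; congr (limn _); apply/funext => N /=.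
by rewrite /u sumEFin.
Qed.

(** The infinite sum exists by absolute convergence, so a bound on all finite
    pieces of the tail passes to the limit. *)
Lemma lim_tail_le (R : realType) (a : nat -> R) (c s T : R) n : 0 < s -> (0 < n)%N ->
  (forall j, (0 < j)%N -> `|a j| <= c * j%:R ^+ 2 * decay R j s) ->
  (forall N, `|\sum_(n <= j < N) a j| <= T) ->
  `|\sum_(1 <= j < n) a j - limn (fun N : nat => \sum_(1 <= j < N) a j)| <= T.
Proof.
move=> s0 n0 ac aT.
(* The library series start at index 0. *)
pose b j := if j is 0 then 0 else a j.
have ub : series b =1 (fun N : nat => \sum_(1 <= j < N) a j).
  move=> N; rewrite /series/=; case: N => [|N]; first by rewrite !big_geq.
  rewrite big_ltn//= add0r; apply: eq_big_nat => -[]//.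
have c0 : 0 <= c.
  have := le_trans (normr_ge0 _) (ac 1%N isT).
  by rewrite expr1n mulr1 pmulr_lge0// expR_gt0.
have cb : cvgn (series b).
  apply: normed_cvg; apply: nondecreasing_is_cvgn.
    by apply: nondecreasing_series => j _ _; exact: normr_ge0.
  exists (c * (512 / s) * 2) => _ [N _ <-].
  apply: (@le_trans _ _ (\sum_(1 <= j < N) c * j%:R ^+ 2 * decay R j s)); last first.
    apply: sum_weighted_decay_le => // j _.
    by rewrite lexx andbT mulr_ge0 ?sqr_ge0.
  rewrite {1}/series/= /series/=; case: N => [|N]; first by rewrite !big_geq.
  rewrite big_ltn//= normr0 add0r; apply: ler_sum_nat => -[|j] // _.
  exact: ac.
rewrite -(funext ub : _ = (fun N : nat => \sum_(1 <= j < N) a j)).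
rewrite distrC.
have cv : `|series b N - \sum_(1 <= j < n) a j| @[N --> \oo] -->
    `|limn (series b) - \sum_(1 <= j < n) a j|.
  by apply: cvg_norm; apply: cvgB => //; exact: cvg_cst.
apply: (cvgr_to_le cv).
near=> N; rewrite ub; have nN : (n <= N)%N by near: N; exact: nbhs_infty_ge.
by rewrite (big_cat_nat n0 nN)/= addrAC subrr add0r.
Unshelve. all: by end_near. Qed.

(** The interface between fixed time and time integration.  It suffices to show
    that [f s] is at most every upper bound [tau] of the partial sums, so that at a
    fixed time one reasons with finite sums only.  The weights are [p j] below [n]
    and [q j^2] from [n] on, and the second part integrates to
    [512 q sum_{j >= n} j^-2]. *)
Lemma time_integral_le (R : realType) n (p : nat -> R) (q t : R) (f : R -> \bar R) :
  (0 < n)%N -> (forall j, 0 <= p j) -> p 0 = 0 -> 0 <= q ->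
  (forall s, 0 < s -> (0 <= f s)%E) ->
  (forall s tau, 0 < s ->
    (forall N, \sum_(1 <= j < n) p j * decay R j s +
       q * \sum_(n <= j < N) j%:R ^+ 2 * decay R j s <= tau) ->
    (f s <= tau%:E)%E) ->
  (\int[@lebesgue_measure R]_(s in `]0%R, t[) f s <=
   (512 * (\sum_(1 <= j < n) p j / j%:R ^+ 4 + q * (2 / n%:R)))%:E)%E.
Proof.
move=> n0 p0 p00 q0 f0 fle.
pose w j : R := if (j < n)%N then p j else q * j%:R ^+ 2.
have w0 j : 0 <= w j by rewrite /w; case: ifP => // _; rewrite mulr_ge0// sqr_ge0.
have w00 : w 0 = 0 by rewrite /w n0.
have split_sum (u v : nat -> R) N : (n <= N)%N -> (forall j, u j = w j * v j) ->
    \sum_(1 <= j < N) u j = \sum_(1 <= j < n) p j * v j +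
      q * \sum_(n <= j < N) j%:R ^+ 2 * v j.
  move=> nN uE; rewrite (big_cat_nat n0 nN)/=; congr (_ + _).
    by apply: eq_big_nat => j /andP[_ jn]; rewrite uE /w jn.
  rewrite big_distrr/=; apply: eq_big_nat => j /andP[nj _].
  by rewrite uE /w ltnNge nj mulrA.
pose c := q + \sum_(0 <= j < n) p j.
have wc j : 0 <= w j <= c * j%:R ^+ 2.
  rewrite w0/= /w; have [->|j0] := posnP j.
    by rewrite n0 p00 mulr_ge0 ?sqr_ge0// addr_ge0// sumr_ge0.
  have j1 : 1 <= j%:R ^+ 2 :> R by rewrite exprn_ege1// ler1n.
  have P0 : 0 <= \sum_(0 <= j < n) p j by rewrite sumr_ge0.
  case: ltnP => jn.
    have pj : p j <= \sum_(0 <= j < n) p j.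
      rewrite big_mkord (bigD1 (Ordinal jn))//= lerDl; exact: sumr_ge0.
    apply: (@le_trans _ _ (c * 1)); first by rewrite mulr1 /c; lra.
    by rewrite ler_wpM2l// addr_ge0.
  by rewrite ler_wpM2r ?sqr_ge0// lerDl.
apply: (@le_trans _ _ (\int[@lebesgue_measure R]_(s in `]0%R, t[)
    \sum_(0 <= j <oo) (w j * decay R j s)%:E)%E).
  apply: le_integral_nonneg => s /=; rewrite in_itv/= => /andP[s0 _]; first exact: f0.
  have [tau wtau ->] := weighted_decay_total R w c s s0 w00 wc.
  apply: fle => // N; have [nN|Nn] := leqP n N.
    by rewrite -(split_sum (fun j => w j * decay R j s)).
  rewrite (big_geq (ltnW Nn)) mulr0 addr0.
  apply: le_trans (wtau n).
  rewrite (split_sum (fun j => w j * decay R j s) (decay R ^~ s) n)//.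
  rewrite [X in q * X]big_geq//.
  by rewrite mulr0 addr0.
apply: integral_weighted_decay_le => // N.
have wk0 j : 0 <= w j * (512 / j%:R ^+ 4).
  apply: mulr_ge0; first exact: w0.
  by apply: divr_ge0; [exact: ler0n|exact: exprn_ge0].
have inc : \sum_(1 <= j < N) w j * (512 / j%:R ^+ 4) <=
    \sum_(1 <= j < maxn N n) w j * (512 / j%:R ^+ 4).
  case: N => [|N]; first by rewrite big_geq//; apply: sumr_ge0 => j _; exact: wk0.
  have NM : (N.+1 <= maxn N.+1 n)%N by exact: leq_maxl.
  rewrite [leRHS](big_cat_nat _ NM)//= lerDl.
  by apply: sumr_ge0 => j _; exact: wk0.
apply: le_trans inc _.
rewrite (split_sum _ (fun j => 512 / j%:R ^+ 4)) ?leq_maxr// mulrDr.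
apply: lerD.
  rewrite big_distrr/=; apply: ler_sum => j _.
  by rewrite mulrCA.
rewrite mulrCA; apply: ler_wpM2l => //.
apply: (@le_trans _ _ (\sum_(n <= j < maxn N n) 512 * j%:R ^- 2)).
  apply: ler_sum_nat => j /andP[nj _]; rewrite mulrCA.
  apply: ler_wpM2l; first exact: ler0n.
  have j0 : j%:R != 0 :> R by rewrite pnatr_eq0 -lt0n (leq_trans n0).
  by have -> : j%:R ^+ 2 / j%:R ^+ 4 = j%:R ^- 2 :> R by field.
rewrite -big_distrr/=; apply: ler_wpM2l; first exact: ler0n.
exact: sum_inv_sqr_le.
Qed.

(** * The three errors at a fixed time *)

Lemma decay_ge0 (R : realType) j (s : R) : 0 <= decay R j s.
Proof. exact: expR_ge0. Qed.

Lemma decay_le1 (R : realType) j (s : R) : 0 <= s -> decay R j s <= 1.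
Proof.
move=> s0; rewrite /decay -[leRHS](@expR0 R) ler_expR oppr_le0.
by apply: divr_ge0; [rewrite mulr_ge0// exprn_ge0|exact: ler0n].
Qed.

Lemma decay_nonincr (R : realType) j (s : R) : 0 <= s ->
  decay R j.+1 s <= decay R j s.
Proof.
move=> s0; rewrite /decay ler_expR lerN2.
apply: ler_wpM2r; first by rewrite invr_ge0 ler0n.
by apply: ler_wpM2r => //; rewrite lerXn2r ?nnegrE// ler_nat.
Qed.

(** From the discrete to the exact kernel through two intermediate sums, with the
    exact coefficients evaluated at [kappa n y] and at [y]: coefficient error [a],
    shift error, tail [T]. *)
Lemma kernel_error_le (R : realType) n (al be : nat -> R) (y a T c s : R) :
  0 < s -> (0 < n)%N ->
  (forall j, (0 < j)%N -> `|be j| <= c * j%:R ^+ 2 * decay R j s) ->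
  \sum_(1 <= j < n) `|al j - be j| <= a ->
  (forall N, `|\sum_(n <= j < N) be j * phi j y| <= T) ->
  `|\sum_(1 <= j < n) al j * phi j (kappa n y) -
    limn (fun N : nat => \sum_(1 <= j < N) be j * phi j y)| <=
  a + `|\sum_(1 <= j < n) be j * phi j (kappa n y) -
        \sum_(1 <= j < n) be j * phi j y| + T.
Proof.
move=> s0 n0 bc ha hT.
have ph j (z u : R) : `|z * phi j u| <= `|z|.
  by rewrite normrM ler_piMr// norm_phi_le1.
have h1 : `|\sum_(1 <= j < n) al j * phi j (kappa n y) -
            \sum_(1 <= j < n) be j * phi j (kappa n y)| <= a.
  rewrite -sumrB; apply: le_trans (ler_norm_sum _ _ _) (le_trans _ ha).
  by apply: ler_sum => j _; rewrite -mulrBl.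
have h2 : `|\sum_(1 <= j < n) be j * phi j y -
    limn (fun N : nat => \sum_(1 <= j < N) be j * phi j y)| <= T.
  apply: (lim_tail_le R _ c s) => // j j0; exact: le_trans (ph _ _ _) (bc j j0).
move: h1 h2; set P := \sum_(1 <= j < n) al j * _.
set Q := \sum_(1 <= j < n) _ * phi j (kappa n y).
set U := \sum_(1 <= j < n) _; set L := limn _ => h1 h2.
have -> : P - L = (P - Q) + (Q - U) + (U - L) by ring.
apply: le_trans (ler_normD _ _) _; apply: lerD => //.
by apply: le_trans (ler_normD _ _) _; exact: lerD.
Qed.

(** With [U] the sum of [j^(5/2) decay], the shift error has squared [L^2] norm
    at most [K ^+ 2] for [K = 4 h U], and the pointwise inequality
    [|B| <= K / 2 + B ^+ 2 / (2 K)] turns this into a bound linear in [K] for the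
    [L^1] norm. *)
Lemma integral_kernel_error_le (R : realType) n (al be : nat -> R) (A s tau : R) :
  0 < s -> (1 < n)%N -> 0 <= A ->
  (forall j, (0 < j < n)%N -> `|al j - be j| <=
     A * j%:R ^+ 2 * (j%:R * mesh R n) ^+ 2 * decay R j s) ->
  (forall j, (0 < j)%N -> `|be j| <= j%:R ^+ 2 * decay R j s) ->
  (forall N, \sum_(1 <= j < n) (4 * A * mesh R n ^+ 2 * j%:R ^+ 4 +
      10 * mesh R n * (j%:R ^+ 2 * Num.sqrt j%:R)) * decay R j s +
     4 * \sum_(n <= j < N) j%:R ^+ 2 * decay R j s <= tau) ->
  (\int[@lebesgue_measure R]_(y in `]0%R, pi[)
     `|\sum_(1 <= j < n) al j * phi j (kappa n y) -
       limn (fun N : nat => \sum_(1 <= j < N) be j * phi j y)|%:E <= tau%:E)%E.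
Proof.
move=> s0 n1 A0 ab bb htau; have n0 : (0 < n)%N by exact: ltnW.
have h0 := mesh_gt0 R n n0.
pose a : R := \sum_(1 <= j < n) A * mesh R n ^+ 2 * (j%:R ^+ 4 * decay R j s).
pose U : R := \sum_(1 <= j < n) j%:R ^+ 2 * Num.sqrt j%:R * decay R j s.
(* What the other two errors leave of the upper bound tau for the tail. *)
pose T : R := (tau - 4 * a - 10 * mesh R n * U) / 4.
have hT N : \sum_(n <= j < N) j%:R ^+ 2 * decay R j s <= T.
  rewrite /T; have := htau N.
  have -> : \sum_(1 <= j < n) (4 * A * mesh R n ^+ 2 * j%:R ^+ 4 +
      10 * mesh R n * (j%:R ^+ 2 * Num.sqrt j%:R)) * decay R j s =
      4 * a + 10 * mesh R n * U.
    rewrite /a /U !big_distrr -big_split/=; apply: eq_bigr => j _; ring.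
  lra.
have a0 : 0 <= a.
  apply: sumr_ge0 => j _; apply: mulr_ge0; first by rewrite mulr_ge0// sqr_ge0.
  by apply: mulr_ge0; [exact: exprn_ge0|exact: decay_ge0].
have T0 : 0 <= T by have := hT n; rewrite big_geq.
have U0 : 0 < U.
  rewrite /U big_ltn// expr1n mul1r sqrtr1 mul1r ltr_wpDr ?expR_gt0//.
  apply: sumr_ge0 => j _; apply: mulr_ge0; last exact: decay_ge0.
  by apply: mulr_ge0; [exact: sqr_ge0|exact: sqrtr_ge0].
(* An upper bound of the L^2 norm of the shift error, by SU below. *)
pose K : R := 4 * mesh R n * U.
have K0 : 0 < K by apply: mulr_gt0 => //; exact: mulr_gt0.
set S := \sum_(1 <= j < n) be j ^+ 2 * j%:R ^+ 2.
have SU : S <= 4 * U ^+ 2.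
  have := sum_sqr_le_sqr_sum R (decay R ^~ s) n (decay_ge0 R ^~ s)
    (fun j => decay_nonincr R j s (ltW s0)).
  apply: le_trans; apply: ler_sum_nat => j /andP[j0 _].
  have -> : j%:R ^+ 6 * decay R j s ^+ 2 = (j%:R ^+ 2 * decay R j s) ^+ 2 * j%:R ^+ 2.
    ring.
  apply: ler_wpM2r; first exact: sqr_ge0.
  rewrite -real_normK ?num_real// ler_sqr ?nnegrE//; first exact: bb.
  by rewrite mulr_ge0 ?sqr_ge0 ?decay_ge0.
have c0 : 0 <= a + T + K / 2 by rewrite !addr_ge0// divr_ge0// ltW.
have m0 : 0 <= 1 / (2 * K) by rewrite divr_ge0// mulr_ge0// ltW.
apply: (@le_trans _ _ (\int[@lebesgue_measure R]_(y in `]0%R, pi[)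
     (a + T + K / 2 + 1 / (2 * K) * (\sum_(1 <= j < n) be j * phi j (kappa n y) -
       \sum_(1 <= j < n) be j * phi j y) ^+ 2)%:E)%E).
  apply: le_integral_nonneg => y _; first by rewrite lee_fin.
  rewrite lee_fin.
  have := kernel_error_le R n al be y a T 1 s s0 n0.
  move=> /(_ _ _ _)/le_trans; apply.
  - by move=> j j0; rewrite mul1r; exact: bb.
  - apply: ler_sum_nat => j jn; apply: le_trans (ab j jn) _.
    by rewrite le_eqVlt; apply/orP; left; apply/eqP; ring.
  - move=> N; apply: le_trans (ler_norm_sum _ _ _) (le_trans _ (hT N)).
    apply: ler_sum_nat => j /andP[nj _]; rewrite normrM.
    apply: (@le_trans _ _ `|be j|); first by rewrite ler_piMr// norm_phi_le1.
    by apply: bb; exact: leq_trans nj.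
  move: (_ - _ : R) => B.
  have : `|B| <= K / 2 + 1 / (2 * K) * B ^+ 2.
    have K2 : 0 < 2 * K by lra.
    rewrite -(ler_pM2r K2).
    have -> : (K / 2 + 1 / (2 * K) * B ^+ 2) * (2 * K) = K ^+ 2 + `|B| ^+ 2.
      by rewrite real_normK ?num_real//; field; rewrite gt_eqF.
    have := sqr_ge0 (`|B| - K); lra.
  lra.
apply: le_trans (integral_affine_kappa_shift_le R n be _ _ n0 c0 m0) _.
rewrite lee_fin -/S.
have : 1 / (2 * K) * (4 * mesh R n ^+ 2 * S) <= K / 2.
  have -> : K / 2 = 1 / (2 * K) * K ^+ 2 by field; rewrite gt_eqF.
  apply: ler_wpM2l => //.
  have := ler_wpM2l (sqr_ge0 (mesh R n)) SU; rewrite /K; lra.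
rewrite /T /K; lra.
Qed.

(** The square of the kernel error is at most three times the sum of the squares
    of the three errors.  The squared sums over modes are made linear by the
    Cauchy-Schwarz inequality: against the constant 1 for the [n] coefficient
    errors, and against [1 / j], whose squares sum to at most [2 / n], for the tail. *)
Lemma integral_sqr_kernel_error_le (R : realType) n (al be : nat -> R) (A s tau : R) :
  0 < s -> (0 < n)%N -> 0 <= A ->
  (forall j, (0 < j < n)%N -> `|al j - be j| <=
     A * (j%:R * mesh R n) ^+ 2 * decay R j s) ->
  (forall j, (0 < j)%N -> `|be j| <= decay R j s) ->
  (forall N, \sum_(1 <= j < n) (12 * n%:R * A ^+ 2 * mesh R n ^+ 4 * j%:R ^+ 4 +
      12 * mesh R n ^+ 2 * j%:R ^+ 2) * decay R j s +
     24 / n%:R * \sum_(n <= j < N) j%:R ^+ 2 * decay R j s <= tau) ->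
  (\int[@lebesgue_measure R]_(y in `]0%R, pi[)
     (`|\sum_(1 <= j < n) al j * phi j (kappa n y) -
       limn (fun N : nat => \sum_(1 <= j < N) be j * phi j y)| ^+ 2)%:E <= tau%:E)%E.
Proof.
move=> s0 n0 A0 ab bb htau.
have nR : 0 < n%:R :> R by rewrite ltr0n.
pose a : R := \sum_(1 <= j < n) A * (j%:R * mesh R n) ^+ 2 * decay R j s.
pose a2 : R := \sum_(1 <= j < n) A ^+ 2 * mesh R n ^+ 4 * (j%:R ^+ 4 * decay R j s).
pose S1 : R := \sum_(1 <= j < n) j%:R ^+ 2 * decay R j s.
(* What the other two errors leave of the upper bound tau for the tail. *)
pose T1 : R := (tau - 12 * n%:R * a2 - 12 * mesh R n ^+ 2 * S1) * (n%:R / 24).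
have e2 j : decay R j s ^+ 2 <= decay R j s.
  by rewrite expr2; apply: ler_piMr; [exact: decay_ge0|exact: decay_le1 (ltW s0)].
have hT1 N : \sum_(n <= j < N) j%:R ^+ 2 * decay R j s <= T1.
  rewrite /T1; have := htau N.
  have -> : \sum_(1 <= j < n) (12 * n%:R * A ^+ 2 * mesh R n ^+ 4 * j%:R ^+ 4 +
      12 * mesh R n ^+ 2 * j%:R ^+ 2) * decay R j s =
      12 * n%:R * a2 + 12 * mesh R n ^+ 2 * S1.
    by rewrite /a2 /S1 !big_distrr -big_split/=; apply: eq_bigr => j _; ring.
  set X := \sum_(n <= j < N) _ => hX.
  have -> : X = 24 / n%:R * X * (n%:R / 24) by field; rewrite gt_eqF.
  apply: ler_wpM2r; first by apply: divr_ge0; rewrite ler0n.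
  lra.
have T10 : 0 <= T1 by have := hT1 n; rewrite big_geq.
have aa : a ^+ 2 <= n%:R * a2.
  have := cauchy_schwarz_sum R (fun j => A * (j%:R * mesh R n) ^+ 2 * decay R j s)
    (fun=> 1) 1 n.
  under eq_bigr do rewrite mulr1.
  move=> /le_trans; apply; rewrite mulrC; apply: ler_pM.
  - by apply: sumr_ge0 => j _; exact: sqr_ge0.
  - by apply: sumr_ge0 => j _; exact: sqr_ge0.
  - under eq_bigr do rewrite expr1n.
    by rewrite sumr_const_nat ler_nat leq_subr.
  apply: ler_sum => j _; have K0 : 0 <= A ^+ 2 * mesh R n ^+ 4 * j%:R ^+ 4.
    apply: mulr_ge0; last exact: exprn_ge0.
    apply: mulr_ge0; first exact: sqr_ge0.
    by apply: exprn_ge0; apply: ltW; exact: mesh_gt0.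
  have := ler_wpM2l K0 (e2 j); lra.
set S := \sum_(1 <= j < n) be j ^+ 2 * j%:R ^+ 2.
have SS : S <= S1.
  apply: ler_sum_nat => j /andP[j0 _]; rewrite mulrC.
  apply: ler_wpM2l; first exact: sqr_ge0.
  apply: le_trans (e2 j).
  by rewrite -real_normK ?num_real// ler_sqr ?nnegrE ?bb// decay_ge0.
pose T : R := Num.sqrt (2 / n%:R * T1).
have T2 : T ^+ 2 = 2 / n%:R * T1 by rewrite sqr_sqrtr// mulr_ge0.
have hT N : \sum_(n <= j < N) decay R j s <= T.
  rewrite -ler_sqr ?nnegrE ?sqrtr_ge0//; last first.
    by apply: sumr_ge0 => j _; exact: decay_ge0.
  rewrite T2.
  rewrite (eq_big_nat _ _ (F2 := fun j => j%:R^-1 * (j%:R * decay R j s))); last first.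
    by move=> j /andP[nj _]; rewrite mulKf// pnatr_eq0 -lt0n (leq_trans n0).
  apply: le_trans (cauchy_schwarz_sum R _ _ n N) _; apply: ler_pM.
  - by apply: sumr_ge0 => j _; exact: sqr_ge0.
  - by apply: sumr_ge0 => j _; exact: sqr_ge0.
  - under eq_bigr do rewrite exprVn.
    exact: sum_inv_sqr_le.
  apply: le_trans (hT1 N); apply: ler_sum => j _; rewrite exprMn.
  by apply: ler_wpM2l; first exact: sqr_ge0.
have a20 : 0 <= n%:R * a2 by apply: le_trans aa; exact: sqr_ge0.
have c0 : 0 <= 3 * (n%:R * a2) + 3 * T ^+ 2 by rewrite addr_ge0// mulr_ge0// sqr_ge0.
have sq3 (E B : R) : `|E| <= a + `|B| + T ->
    `|E| ^+ 2 <= 3 * (n%:R * a2) + 3 * T ^+ 2 + 3 * B ^+ 2.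
  move=> h; have abT : 0 <= a + `|B| + T by apply: le_trans h.
  apply: (@le_trans _ _ ((a + `|B| + T) ^+ 2)); first by rewrite ler_sqr ?nnegrE.
  rewrite -(real_normK (num_real B)).
  have := sqr_ge0 (a - `|B|); have := sqr_ge0 (a - T); have := sqr_ge0 (`|B| - T).
  lra.
apply: (@le_trans _ _ (\int[@lebesgue_measure R]_(y in `]0%R, pi[)
     (3 * (n%:R * a2) + 3 * T ^+ 2 + 3 * (\sum_(1 <= j < n) be j * phi j (kappa n y) -
       \sum_(1 <= j < n) be j * phi j y) ^+ 2)%:E)%E).
  apply: le_integral_nonneg => y _; first by rewrite lee_fin sqr_ge0.
  rewrite lee_fin.
  have key := kernel_error_le R n al be y a T 1 s s0 n0.
  have {key} : `|\sum_(1 <= j < n) al j * phi j (kappa n y) -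
       limn (fun N : nat => \sum_(1 <= j < N) be j * phi j y)| <= a +
    `|\sum_(1 <= j < n) be j * phi j (kappa n y) -
        \sum_(1 <= j < n) be j * phi j y| + T.
    apply: key.
    - move=> j j0; rewrite mul1r; apply: le_trans (bb j j0) _.
      by apply: ler_peMl; [exact: decay_ge0|rewrite exprn_ege1// ler1n].
    - by apply: ler_sum_nat => j jn; exact: ab.
    - move=> N; apply: le_trans (ler_norm_sum _ _ _) (le_trans _ (hT N)).
      apply: ler_sum_nat => j /andP[nj _]; rewrite normrM.
      apply: (@le_trans _ _ `|be j|); first by rewrite ler_piMr// norm_phi_le1.
      by apply: bb; exact: leq_trans nj.
  exact: sq3.
apply: le_trans (integral_affine_kappa_shift_le R n be _ 3 n0 c0 _) _ => //.
rewrite lee_fin -/S.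
have := ler_wpM2l (sqr_ge0 (mesh R n)) SS.
have : 24 / n%:R * T1 = tau - 12 * n%:R * a2 - 12 * mesh R n ^+ 2 * S1.
  by rewrite /T1; field; rewrite gt_eqF.
rewrite T2; lra.
Qed.

(** * The estimates integrated in time *)

Lemma sum_pow4_div_le (R : realType) n (u v : R) (r : nat -> R) : 0 <= u ->
  \sum_(1 <= j < n) (u * j%:R ^+ 4 + v * r j) / j%:R ^+ 4 <=
  n%:R * u + v * \sum_(1 <= j < n) r j / j%:R ^+ 4.
Proof.
move=> u0.
rewrite (eq_big_nat _ _ (F2 := fun j => u + v * (r j / j%:R ^+ 4))); last first.
  move=> j /andP[j0 _]; rewrite mulrDl mulfK ?mulrA//.
  by rewrite expf_neq0// pnatr_eq0 -lt0n.
rewrite big_split/= -big_distrr/= sumr_const_nat lerD2r -[u *+ _]mulr_natl.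
by apply: ler_wpM2r => //; rewrite ler_nat leq_subr.
Qed.

Lemma mesh_le (R : realType) n : mesh R n <= 4 / n%:R.
Proof.
rewrite /mesh; apply: ler_wpM2r; first by rewrite invr_ge0.
have := pihalf_lt2 R; lra.
Qed.

Lemma lap_greenn_L1_error (R : realType) : exists2 C : R, 0 <= C &
  forall (n : nat) (x t : R), (2 <= n)%N ->
    (\int[@lebesgue_measure R]_(s in `]0%R, t[)
       \int[@lebesgue_measure R]_(y in `]0%R, pi[)
         `|lap_greenn n s x y - lap_green s x y|%:E <= (C / n%:R)%:E)%E.
Proof.
have [A A0 hA] : exists2 A : R, 0 <= A & forall j n (x s : R), (0 < j < n)%N -> 0 <= s ->
  `|lamn R j n * expR (- (lamn R j n ^+ 2 * s)) * phin j n x -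
    lam R j * expR (- (lam R j ^+ 2 * s)) * phi j x|
  <= A * j%:R ^+ 2 * (j%:R * mesh R n) ^+ 2 * decay R j s.
  by exists 1029; [exact: ler0n|exact: lap_coef_le].
exists (512 * (64 * A + 168)); first by apply: mulr_ge0; [exact: ler0n|lra].
move=> n x t n2; have n0 : (0 < n)%N by exact: ltnW.
have nR : 0 < n%:R :> R by rewrite ltr0n.
have h0 := mesh_gt0 R n n0.
pose p j : R := 4 * A * mesh R n ^+ 2 * j%:R ^+ 4 +
  10 * mesh R n * (j%:R ^+ 2 * Num.sqrt j%:R).
have u0 : 0 <= 4 * A * mesh R n ^+ 2.
  by apply: mulr_ge0; [lra|exact: sqr_ge0].
have p0 j : 0 <= p j.
  apply: addr_ge0; first by apply: mulr_ge0 => //; exact: exprn_ge0.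
  apply: mulr_ge0; first lra.
  by apply: mulr_ge0; [exact: sqr_ge0|exact: sqrtr_ge0].
have p00 : p 0 = 0 by rewrite /p !expr0n/= mul0r !mulr0 addr0.
apply: (le_trans (time_integral_le R n p 4 t _ n0 p0 p00 (ler0n _ _) _ _)).
- by move=> s _; apply: integral_ge0 => y _; rewrite lee_fin.
- move=> s tau s0 htau; rewrite /lap_greenn /lap_green.
  apply: (integral_kernel_error_le R n
    (fun j => lamn R j n * expR (- (lamn R j n ^+ 2 * s)) * phin j n x)
    (fun j => lam R j * expR (- (lam R j ^+ 2 * s)) * phi j x) A s tau) => //.
    by move=> j jn; apply: hA => //; exact: ltW.
  move=> j _; rewrite normrM.
  apply: (@le_trans _ _ `|lam R j * expR (- (lam R j ^+ 2 * s))|).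
    by apply: ler_piMr => //; exact: norm_phi_le1.
  have nl : `|lam R j| = j%:R ^+ 2 by rewrite /lam normrN ger0_norm ?sqr_ge0.
  rewrite normrM nl; apply: ler_wpM2l; first exact: sqr_ge0.
  by rewrite ger0_norm ?expR_ge0//; exact: expR_lam_le (ltW s0).
rewrite lee_fin -[leRHS]mulrA; apply: ler_wpM2l; first exact: ler0n.
have := sum_pow4_div_le R n _ (10 * mesh R n) (fun j => j%:R ^+ 2 * Num.sqrt j%:R) u0.
have -> : \sum_(1 <= j < n) j%:R ^+ 2 * Num.sqrt j%:R / j%:R ^+ 4 =
    \sum_(1 <= j < n) Num.sqrt j%:R / j%:R ^+ 2 :> R.
  by apply: eq_big_nat => j /andP[j0 _]; field; rewrite pnatr_eq0 -lt0n.
have := sum_inv_sqrt3_le R n.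
rewrite -[\sum_(1 <= j < n) (_ + _) / _]/(\sum_(1 <= j < n) p j / j%:R ^+ 4).
move: (\sum_(1 <= j < n) p j / _) (\sum_(1 <= j < n) _ / _) => X Y Y4 XY.
have hn := mesh_le R n.
have h2 : n%:R * mesh R n ^+ 2 <= 16 / n%:R.
  have -> : 16 / n%:R = n%:R * (4 / n%:R) ^+ 2 :> R by field; rewrite gt_eqF.
  apply: ler_wpM2l; first exact: ltW.
  by rewrite ler_sqr ?nnegrE// ?ltW// divr_gt0.
have h3 : mesh R n * Y <= 4 * (4 / n%:R).
  have := ler_wpM2l (ltW h0) Y4; lra.
have := ler_wpM2l A0 h2; lra.
Qed.

Lemma greenn_L2_error (R : realType) : exists2 C : R, 0 <= C &
  forall (n : nat) (x t : R), (2 <= n)%N ->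
    (\int[@lebesgue_measure R]_(s in `]0%R, t[)
       \int[@lebesgue_measure R]_(y in `]0%R, pi[)
         (`|greenn n s x y - green s x y| ^+ 2)%:E <= (C / n%:R ^+ 2)%:E)%E.
Proof.
have [A A0 hA] : exists2 A : R, 0 <= A & forall j n (x s : R), (0 < j < n)%N -> 0 <= s ->
  `|expR (- (lamn R j n ^+ 2 * s)) * phin j n x -
    expR (- (lam R j ^+ 2 * s)) * phi j x|
  <= A * (j%:R * mesh R n) ^+ 2 * decay R j s.
  by exists 1028; [exact: ler0n|exact: green_coef_le].
exists (512 * (3072 * A ^+ 2 + 432)).
  apply: mulr_ge0; [exact: ler0n|apply: addr_ge0; [|exact: ler0n]].
  by apply: mulr_ge0; [exact: ler0n|exact: sqr_ge0].
move=> n x t n2; have n0 : (0 < n)%N by exact: ltnW.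
have nR : 0 < n%:R :> R by rewrite ltr0n.
have h0 := mesh_gt0 R n n0.
pose p j : R := 12 * n%:R * A ^+ 2 * mesh R n ^+ 4 * j%:R ^+ 4 +
  12 * mesh R n ^+ 2 * j%:R ^+ 2.
have v0 : 0 <= 12 * mesh R n ^+ 2.
  by apply: mulr_ge0; [exact: ler0n|exact: sqr_ge0].
have u0 : 0 <= 12 * n%:R * A ^+ 2 * mesh R n ^+ 4.
  apply: mulr_ge0; last by apply: exprn_ge0; exact: ltW.
  apply: mulr_ge0; last exact: sqr_ge0.
  by apply: mulr_ge0; exact: ler0n.
have p0 j : 0 <= p j.
  apply: addr_ge0; first by apply: mulr_ge0 => //; exact: exprn_ge0.
  by apply: mulr_ge0 => //; exact: sqr_ge0.
have p00 : p 0 = 0 by rewrite /p !expr0n/= !mulr0 addr0.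
have q0 : 0 <= 24 / n%:R :> R by apply: divr_ge0; exact: ler0n.
apply: (le_trans (time_integral_le R n p _ t _ n0 p0 p00 q0 _ _)).
- by move=> s _; apply: integral_ge0 => y _; rewrite lee_fin sqr_ge0.
- move=> s tau s0 htau; rewrite /greenn /green.
  apply: (integral_sqr_kernel_error_le R n
    (fun j => expR (- (lamn R j n ^+ 2 * s)) * phin j n x)
    (fun j => expR (- (lam R j ^+ 2 * s)) * phi j x) A s tau) => //.
    by move=> j jn; apply: hA => //; exact: ltW.
  move=> j _; rewrite normrM; apply: (@le_trans _ _ `|expR (- (lam R j ^+ 2 * s))|).
    by apply: ler_piMr => //; exact: norm_phi_le1.
  by rewrite ger0_norm ?expR_ge0//; exact: expR_lam_le (ltW s0).
rewrite lee_fin -[leRHS]mulrA; apply: ler_wpM2l; first exact: ler0n.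
have := sum_pow4_div_le R n _ (12 * mesh R n ^+ 2) (fun j => j%:R ^+ 2) u0.
have -> : \sum_(1 <= j < n) j%:R ^+ 2 / j%:R ^+ 4 =
    \sum_(1 <= j < n) j%:R ^- 2 :> R.
  by apply: eq_big_nat => j /andP[j0 _]; field; rewrite pnatr_eq0 -lt0n.
have := sum_inv_sqr_le R 1 n isT; rewrite divr1.
rewrite -[\sum_(1 <= j < n) (_ + _) / _]/(\sum_(1 <= j < n) p j / j%:R ^+ 4).
move: (\sum_(1 <= j < n) p j / _) (\sum_(1 <= j < n) _) => X Y Y2 XY.
have h2 : mesh R n ^+ 2 <= 16 / n%:R ^+ 2.
  have -> : 16 / n%:R ^+ 2 = (4 / n%:R) ^+ 2 :> R by field; rewrite gt_eqF.
  rewrite ler_sqr ?nnegrE; [exact: mesh_le|exact: ltW|].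
  by apply: divr_ge0; exact: ler0n.
have h4 : n%:R * n%:R * mesh R n ^+ 4 <= 256 / n%:R ^+ 2.
  have -> : 256 / n%:R ^+ 2 = n%:R * n%:R * (16 / n%:R ^+ 2) ^+ 2 :> R.
    by field; rewrite gt_eqF.
  have -> : mesh R n ^+ 4 = (mesh R n ^+ 2) ^+ 2 by ring.
  apply: ler_wpM2l; first by apply: mulr_ge0; exact: ltW.
  have h20 : 0 <= 16 / n%:R ^+ 2 :> R by apply: le_trans h2; exact: sqr_ge0.
  by rewrite ler_sqr ?nnegrE ?sqr_ge0.
have h3 : mesh R n ^+ 2 * Y <= 2 * (16 / n%:R ^+ 2).
  have := ler_wpM2l (sqr_ge0 (mesh R n)) Y2; lra.
have -> : 24 / n%:R * (2 / n%:R) = 48 / n%:R ^+ 2 :> R by field; rewrite gt_eqF.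
have := ler_wpM2l (sqr_ge0 A) h4; lra.
Qed.

Theorem lemma3p1 (R : realType) (T : R) (hT : 0 < T) :
  exists C : R, forall (n : nat) (x t : R),
    (2 <= n)%N -> 0 < x < pi -> 0 < t <= T ->
    (\int[@lebesgue_measure R]_(s in `]0%R, t[)
       \int[@lebesgue_measure R]_(y in `]0%R, pi[)
         `|lap_greenn n s x y - lap_green s x y|%:E <= (C / n%:R)%:E)%E
    /\
    (\int[@lebesgue_measure R]_(s in `]0%R, t[)
       \int[@lebesgue_measure R]_(y in `]0%R, pi[)
         (`|greenn n s x y - green s x y| ^+ 2)%:E <= (C / n%:R ^+ 2)%:E)%E.
Proof.
have [C1 C10 h1] := lap_greenn_L1_error R.
have [C2 C20 h2] := greenn_L2_error R.
exists (C1 + C2) => n x t n2 _ _; split.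
  apply: le_trans (h1 n x t n2) _; rewrite lee_fin; apply: ler_wpM2r.
    by rewrite invr_ge0.
  by rewrite lerDl.
apply: le_trans (h2 n x t n2) _; rewrite lee_fin; apply: ler_wpM2r.
  by rewrite invr_ge0 sqr_ge0.
by rewrite lerDr.
Qed.
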